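(* Let $R=\mathbb{C}[x_0,\ldots,x_n]$ and let $I=(F_1,\ldots,F_r)\subset R$ be an artinian ideal generated by $r$ homogeneous polynomials of degree $d$. Let $i,k,\delta$ be integers such that $i\ge0$, $k\ge1$. Assume that there is no syzygy of degree $i$ among the $F_j$'s. Let $N(r,i,k,d)=r(r_i-r_{i-k})-(r_{d+i}-r_{d+i-k})$, $N^+=\sup(0,N(r,i,k,d))$, $N^-=\sup(0,-N(r,i,k,d))$. The following conditions are equivalent: (1) The ideal $I$ fails the SLP at the range $k$ in degree $d+i-k$. (2) There exist $N^++\delta$, with $\delta\ge1$, independent vectors $(G_{1j},\ldots,G_{rj})_{j=1,\ldots,N^++\delta}\in R_i^{\oplus r}$ and $N^++\delta$ forms $G_j\in R_{d+i-k}$ such that $G_{1j}F_1+\cdots+G_{rj}F_r=L^kG_j$ for a general linear form $L$ of $\mathbb{P}^n$. (3) The $n$-dimensional variety $\pi_{I_{d+i}}(v_{d+i}(\mathbb{P}^n))$ satisfies $\delta\ge1$ Laplace equations of order $d+i-k$. (4) For any $L\in R_1$, $$\dim_{\mathbb{C}}\left((I_{d+i}^{\perp})^*\cap\mathrm{H}^0(\mathcal{I}_{L^\vee}^{\,d+i-k+1}(d+i))\right)\ge N^-+\delta,\quad\text{with }\delta\ge1 .$$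
   Context: The ground field is $\mathbb{C}$; $R=\bigoplus_t R_t$ and $r_t=\dim R_t=\dim\mathrm{H}^0(\mathcal{O}_{\mathbb{P}^n}(t))$. $I_{d+i}=R_iF_1+\cdots+R_iF_r$. No syzygy of degree $i$ means that there is no nonzero $(G_1,\ldots,G_r)\in R_i^{\oplus r}$ with $\sum_j G_jF_j=0$. With $A=R/I=\bigoplus_jA_j$, $I$ fails the SLP (Strong Lefschetz Property) at the range $k$ in degree $j$ if for every linear form $L$ the map $\times L^k:A_j\to A_{j+k}$ does not have maximal rank (is neither injective nor surjective). Veronese and projection: $v_t:[L]\mapsto[L^t]$ is the Veronese embedding of the projective space of linear forms in the projective space of forms of degree $t$; $\pi_{I_{d+i}}$ is the linear projection whose center is the projective space of $I_{d+i}$, with image in the projective space of $R_{d+i}/I_{d+i}$. Laplace equations: the $s$-th osculating space to an $n$-dimensional variety $X\subset\mathbb{P}^M$ at a point $P$ is the subspace spanned by $P$ and all the derivative points of order at most $s$ of a local parametrization of $X$ at $P$. $X$ satisfies $\delta$ (independent) Laplace equations of order $s$ if its $s$-th osculating space at a general point has dimension $\inf\left(\binom{n+s}{n}-1,M\right)-\delta$; the relations that exist automatically when $M<\binom{n+s}{n}-1$ are trivial and not counted. Apolarity: $I_{d+i}^\perp=\{\delta\in R_{d+i}^*\mid\delta(F)=0\ \forall F\in I_{d+i}\}$, where $R_{d+i}^*$ is identified with derivations of order $d+i$, and $(I_{d+i}^\perp)^*\simeq R_{d+i}/I_{d+i}$ is viewed as a space of forms of degree $d+i$ on the dual projective space.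 $L^\vee$ is the point of the dual projective space corresponding to $L$, $\mathcal{I}_{L^\vee}$ is its ideal sheaf, and $\mathrm{H}^0(\mathcal{I}_{L^\vee}^{m}(d+i))$ is the space of forms of degree $d+i$ with multiplicity at least $m$ at $L^\vee$.
   Formalization: For i ≥ k the claim is false as stated (e.g. (x²,y²), i=k=1): the vectors in (2) are taken independent modulo L^k R_{i-k}^r, and in (3) the δ ≥ 1 Laplace equations are counted beyond min(N^-, r·r_{i-k}) automatic ones. For i < k nothing changes. *)

(* Defs.v *)
From HB Require Import structures.
From mathcomp Require Import all_boot all_order all_algebra.
From mathcomp Require Import reals complex.
From mathcomp Require Import mpoly.

Set Implicit Arguments.
Unset Strict Implicit.
Unset Printing Implicit Defensive.

Import Order.TTheory GRing.Theory Num.Theory.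
Local Open Scope ring_scope.

(* R = C[x_0, ..., x_n] is {mpoly C[n.+1]}.  Degrees such as d + i - k may be  *)
(* negative, so they are integers, with R_t = 0 for t < 0.  For t >= 0 the     *)
(* vector space R_t is the library's [dhomog n.+1 C t].                        *)

Definition is_form (C : fieldType) (n : nat) (t : int) (p : {mpoly C[n.+1]}) : bool :=
  match t with
  | Posz m => p \is m.-homog
  | Negz _ => p == 0
  end.

Definition rdim (C : fieldType) (n : nat) (t : int) : nat :=
  match t with
  | Posz m => \dim {: dhomog n.+1 C m}
  | Negz _ => 0%N
  end.

Definition Nnum (C : fieldType) (n r i k d : nat) : int :=
  r%:Z * ((rdim C n i)%:Z - (rdim C n (i%:Z - k%:Z))%:Z)
  - ((rdim C n (d + i)%N)%:Z - (rdim C n ((d + i)%:Z - k%:Z))%:Z).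

Definition Nplus (C : fieldType) (n r i k d : nat) : nat :=
  absz (Num.max 0 (Nnum C n r i k d)).

Definition Nminus (C : fieldType) (n r i k d : nat) : nat :=
  absz (Num.max 0 (- Nnum C n r i k d)).

(* ---- Ideals ---- *)

Definition is_ideal (A : comNzRingType) (J : A -> Prop) : Prop :=
  [/\ J 0, forall p q, J p -> J q -> J (p + q) & forall a p, J p -> J (a * p)].

Definition gen_ideal (A : comNzRingType) (r : nat) (F : 'I_r -> A) (p : A) : Prop :=
  exists G : 'I_r -> A, p = \sum_(j < r) G j * F j.

(* The quotient ring by I is artinian: its ideals are the ideals J containing  *)
(* I, and they satisfy the descending chain condition.                         *)
Definition artinian_ideal (A : comNzRingType) (I : A -> Prop) : Prop :=
  forall J : nat -> A -> Prop,
    (forall t, is_ideal (J t)) ->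
    (forall t p, I p -> J t p) ->
    (forall t p, J t.+1 p -> J t p) ->
    exists t0, forall t, (t0 <= t)%N -> forall p, J t p <-> J t0 p.

Definition mul_form (C : fieldType) (n d i : nat)
    (F : dhomog n.+1 C d) (G : dhomog n.+1 C i) : dhomog n.+1 C (d + i) :=
  DHomog (dhomogM (dhomog_is_dhomog F) (dhomog_is_dhomog G)).

Lemma mul_form_is_linear (C : fieldType) (n d i : nat) (F : dhomog n.+1 C d) :
  linear (@mul_form C n d i F).
Proof.
move=> c p q; apply: val_inj => /=.
by rewrite mulrDr scalerAr.
Qed.

HB.instance Definition _ (C : fieldType) (n d i : nat) (F : dhomog n.+1 C d) :=
  GRing.isLinear.Build C (dhomog n.+1 C i) (dhomog n.+1 C (d + i)) _
    (@mul_form C n d i F) (@mul_form_is_linear C n d i F).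

(* I_{d+i} = R_i F_1 + ... + R_i F_r *)
Definition ideal_part (C : fieldType) (n r d : nat) (F : 'I_r -> dhomog n.+1 C d)
    (i : nat) : {vspace dhomog n.+1 C (d + i)} :=
  (\sum_(j < r) limg (linfun (@mul_form C n d i (F j))))%VS.

Definition no_syzygy (C : fieldType) (n r d : nat) (F : 'I_r -> dhomog n.+1 C d)
    (i : nat) : Prop :=
  forall G : 'I_r -> dhomog n.+1 C i,
    \sum_(j < r) (G j : {mpoly C[n.+1]}) * F j = 0 -> forall j, G j = 0.

(* ---- Strong Lefschetz property ---- *)

(* Injectivity and surjectivity of the multiplication by M from the degree j   *)
(* part to the degree e part of R/I, written on representatives.               *)
Definition mult_inj (C : fieldType) (n : nat) (I : {mpoly C[n.+1]} -> Prop)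
    (M : {mpoly C[n.+1]}) (j : int) : Prop :=
  forall p, is_form j p -> I (M * p) -> I p.

Definition mult_surj (C : fieldType) (n : nat) (I : {mpoly C[n.+1]} -> Prop)
    (M : {mpoly C[n.+1]}) (j e : int) : Prop :=
  forall q, is_form e q -> exists2 p, is_form j p & I (q - M * p).

Definition fails_SLP (C : fieldType) (n : nat) (I : {mpoly C[n.+1]} -> Prop)
    (k : nat) (j : int) : Prop :=
  forall L : {mpoly C[n.+1]}, L \is 1.-homog ->
    ~ mult_inj I (L ^+ k) j /\ ~ mult_surj I (L ^+ k) j (j + k%:Z).

(* ---- General points ---- *)

(* P holds on a nonempty Zariski open subset of C^m. *)
Definition general (C : fieldType) (m : nat) (P : ('I_m -> C) -> Prop) : Prop :=
  exists2 q : {mpoly C[m]}, q != 0 & forall a, q.@[a] != 0 -> P a.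

(* L^\vee, as the vector of the coefficients of L. *)
Definition dual_point (C : fieldType) (n : nat) (L : {mpoly C[n.+1]}) :
    'I_n.+1 -> C :=
  fun j => L@_(U_(j))%MM.

Definition general_linear_form (C : fieldType) (n : nat)
    (P : {mpoly C[n.+1]} -> Prop) : Prop :=
  exists2 q : {mpoly C[n.+1]}, q != 0 &
    forall L, L \is 1.-homog -> q.@[dual_point L] != 0 -> P L.

(* ---- Independence modulo L^k ---- *)

(* The q vectors G_l of R_i^r are linearly independent in the quotient         *)
(* (R_i / L^k R_{i-k})^r, whose dimension r (r_i - r_{i-k}) is the first term  *)
(* of [Nnum].  For i < k one has R_{i-k} = 0 and this is linear independence   *)
(* in R_i^r; for i >= k the vectors of L^k R_{i-k}^r are trivial solutions of  *)
(* sum_j G_j F_j = L^k H and must not be counted.                              *)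
Definition independent_mod_power (C : fieldType) (n r i k q : nat)
    (L : {mpoly C[n.+1]}) (G : 'I_q -> 'I_r -> dhomog n.+1 C i) : Prop :=
  forall c : 'I_q -> C,
    (exists Q : 'I_r -> {mpoly C[n.+1]},
       forall j, is_form (i%:Z - k%:Z) (Q j) /\
         \sum_(l < q) c l *: (G l j : {mpoly C[n.+1]}) = L ^+ k * Q j) ->
    forall l, c l = 0.

(* ---- Osculating spaces and Laplace equations ---- *)

(* A function X : 'X_{1..m < b} -> V encodes the polynomial map                *)
(* t |-> sum_beta t^beta X(beta) from C^m to V, a lift of a local              *)
(* parametrization with values in P(V).                                        *)
Definition partial_at (C : fieldType) (V : vectType C) (m b : nat)
    (X : 'X_{1..m < b} -> V) (alpha : 'X_{1..m}) (t : 'I_m -> C) : V :=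
  \sum_(beta : 'X_{1..m < b}) ('X_[C, beta]^`M[alpha]).@[t] *: X beta.

(* The linear subspace of V underlying the s-th osculating space at t.         *)
Definition osculating (C : fieldType) (V : vectType C) (m b : nat)
    (X : 'X_{1..m < b} -> V) (s : int) (t : 'I_m -> C) : {vspace V} :=
  match s with
  | Posz s' => <<[seq partial_at X alpha t | alpha : 'X_{1..m < s'.+1}]>>%VS
  | Negz _ => 0%VS
  end.

Definition osc_binomial (m : nat) (s : int) : nat :=
  match s with
  | Posz s' => 'C(m + s', m)
  | Negz _ => 0%N
  end.

(* X, with values in P(W), satisfies delta Laplace equations of order s;       *)
(* dimensions are projective ones.                                             *)
Definition satisfies_laplace (C : fieldType) (V : vectType C) (W : {vspace V})
    (m b : nat) (X : 'X_{1..m < b} -> V) (s : int) (delta : nat) : Prop :=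
  general (fun t : 'I_m -> C =>
    (\dim (osculating X s t))%:Z - 1 =
    Num.min ((osc_binomial m s)%:Z - 1) ((\dim W)%:Z - 1) - delta%:Z).

(* v_D in the chart [x_0 + t_1 x_1 + ... + t_n x_n] of P^n: the value at beta  *)
(* is the coefficient of t^beta in (x_0 + t_1 x_1 + ... + t_n x_n)^D.          *)
Definition veronese (C : fieldType) (n D : nat) :
    'X_{1..n < D.+1} -> dhomog n.+1 C D :=
  fun beta => indhomog D
    (((('X_ord0 : {mpoly C[n.+1]})%:MP_[n]
       + \sum_(j < n) ('X_(lift ord0 j) : {mpoly C[n.+1]})%:MP_[n] * 'X_j) ^+ D)
      @_(beta : 'X_{1..n})).

(* The linear projection of P(V) from the center P(U); V/U is realized as the  *)
(* complement U^C of U.                                                        *)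
Definition linear_projection (C : fieldType) (V : vectType C) (U : {vspace V}) :
    'End(V) := daddv_pi (U^C) U.

Definition projected_veronese (C : fieldType) (n D : nat)
    (U : {vspace dhomog n.+1 C D}) : 'X_{1..n < D.+1} -> dhomog n.+1 C D :=
  fun beta => linear_projection U (@veronese C n D beta).

(* The number of Laplace equations of order s = d + i - k, in the sense of     *)
(* [satisfies_laplace], that the projected Veronese variety has automatically  *)
(* because L^k I_s is contained in I_{d+i}: it is                              *)
(*   inf(r_s - 1, M) - inf(r_s - 1 - dim I_s, M)                               *)
(* with dim I_s = r r_{i-k} and M + 1 = r_{d+i} - r r_i.                       *)
Definition trivial_laplace (C : fieldType) (n r i k d : nat) : nat :=
  minn (Nminus C n r i k d) (r * rdim C n (i%:Z - k%:Z)).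

Lemma trivial_laplace_eq0 (C : fieldType) (n r i k d : nat) :
  (i < k)%N -> trivial_laplace C n r i k d = 0%N.
Proof.
move=> ltik; rewrite /trivial_laplace.
have -> : i%:Z - k%:Z = Negz (k - i).-1.
  by rewrite NegzE prednK ?subn_gt0 // -subzn ?(ltnW ltik) // opprB.
by rewrite muln0 minn0.
Qed.

(* ---- Apolarity and fat points ---- *)

(* The dual ring is again {mpoly C[n.+1]}, its i-th variable being d/dx_i: its *)
(* elements act on R as differential operators, and they are functions of the  *)
(* coefficients of L, i.e. on the dual projective space.                       *)
Definition diff_action (C : fieldType) (n : nat) (f p : {mpoly C[n.+1]}) :
    {mpoly C[n.+1]} :=
  \sum_(m <- msupp f) f@_m *: p^`M[m].

(* Membership in the inverse system U^\perp. *)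
Definition apolar (C : fieldType) (n D : nat) (U : {vspace dhomog n.+1 C D})
    (f : dhomog n.+1 C D) : Prop :=
  forall F, F \in U -> diff_action f F = 0.

Definition multiplicity_ge (C : fieldType) (n : nat) (m : int) (a : 'I_n -> C)
    (f : {mpoly C[n]}) : Prop :=
  forall alpha : 'X_{1..n}, (mdeg alpha)%:Z < m -> (f^`M[alpha]).@[a] = 0.

(* dim P >= q, for a linear subspace P. *)
Definition dim_ge (C : fieldType) (V : vectType C) (P : V -> Prop) (q : nat) : Prop :=
  exists2 X : q.-tuple V, free X & forall v, v \in X -> P v.

(* Main.v *)
(* Put D = d + i and s = D - k.  All four conditions only involve the rank
   rk(L) of the multiplication by L^k from (R/I)_s to (R/I)_D: they say that
   rk(L) is smaller than M = min(dim (R/I)_s, dim (R/I)_D), for every L or for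
   a general L.  As there is no syzygy of degree i, dim I_D = r r_i and
   dim I_s = r r_(i-k), so that N = dim (R/I)_s - dim (R/I)_D.
   - The solutions of sum_j G_j F_j = L^k H, modulo the trivial ones, form the
     kernel of the multiplication, of dimension N^+ + (M - rk(L)).
   - The s-th osculating space of the Veronese variety at L^D is L^k R_s
     (characteristic 0), so that its projection has dimension rk(L).
   - A form f of degree D vanishes at the dual point of L with multiplicity
     s + 1 iff it is apolar to L^k R_s, so that the space in the fourth
     condition is the orthogonal of I_D + L^k R_s, of dimension
     N^- + (M - rk(L)).
   The rank is lower semicontinuous in L, so "for every L" and "for a general
   L" agree.  If s < 0, all four conditions fail. *)

Require Import Defs.
From HB Require Import structures.
From mathcomp Require Import all_boot all_order all_algebra.
From mathcomp Require Import reals complex.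
From mathcomp Require Import ssrcomplements mpoly ring zify.
From mathcomp Require boolp.

Set Implicit Arguments.
Unset Strict Implicit.
Unset Printing Implicit Defensive.

Import Order.TTheory GRing.Theory Num.Theory.
Local Open Scope ring_scope.

Import VectorInternalTheory.

(** * Semicontinuity of the rank and linear algebra *)

(** In characteristic 0 the first [size p] natural numbers are distinct in [C], and they are too
    many to be all roots of [p]. *)
Lemma poly_exists_nonroot (C : numFieldType) (p : {poly C}) :
  p != 0 -> exists x, ~~ root p x.
Proof.
move=> p0; pose s : seq C := [seq j%:R | j <- iota 0 (size p)].
have us : uniq s by rewrite map_inj_uniq ?iota_uniq // => a b /eqP; rewrite eqr_nat => /eqP.
have /allPn[x _ hx] : ~~ all (root p) s.
  apply/negP => /(max_poly_roots p0) /(_ us).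
  by rewrite size_map size_iota ltnn.
by exists x.
Qed.

(** Splitting off the last variable keeps all coefficients, so [muni] of a nonzero polynomial is
    nonzero. This starts the induction on the number of variables below. *)
Lemma coef_muni (R : comNzRingType) n (p : {mpoly R[n.+1]}) (m : 'X_{1..n.+1}) :
  ((muni p)`_(m ord_max))@_[multinom m (widen_ord (leqnSn n) j) | j < n] = p@_m.
Proof.
rewrite [p in LHS]mpolyE /muni raddf_sum /= -/(muni _).
rewrite [p in RHS]mpolyE raddf_sum coef_sum raddf_sum /=; apply: eq_bigr => m' _.
rewrite -/(muni (_ *: 'X_[m'])) muniZ coefZ mul_mpolyC !mcoeffZ; congr (_ * _).
rewrite muniE msuppX big_seq1 mcoeffX eqxx scale1r coefZ coefXn mcoeffX.
have [e0|ne] := eqVneq (m ord_max) (m' ord_max); last first.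
  rewrite mulr0 mcoeff0; case: eqP => // e; by rewrite e eqxx in ne.
rewrite mulr1 mcoeffX; congr (_ %:R); congr nat_of_bool.
apply/eqP/eqP => [e|->] //; apply/mnmP => j.
have [->|ne] := eqVneq j ord_max; first by rewrite e0.
have ltj : (j < n)%N by rewrite ltn_neqAle -ltnS ltn_ord andbT;
  apply: contra ne => /eqP ?; apply/eqP/val_inj.
move/mnmP/(_ (Ordinal ltj)): e; rewrite !mnmE.
by have -> : widen_ord (leqnSn n) (Ordinal ltj) = j by apply: val_inj.
Qed.

Lemma meval_muni (R : comNzRingType) n (p : {mpoly R[n.+1]}) (v : 'I_n.+1 -> R) :
  p.@[v] = (map_poly (meval (fun j => v (widen_ord (leqnSn n) j))) (muni p)).[v ord_max].
Proof.
rewrite [p in LHS]mpolyE muniE !raddf_sum horner_sum /=; apply: eq_bigr => m _.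
rewrite mevalZ mevalX map_polyZ map_polyXn hornerZ hornerXn /= mevalZ mevalX.
rewrite big_ord_recr /= mulrA; congr (_ * _ * _).
by apply: eq_bigr => j _; rewrite mnmE.
Qed.

(** Induction on [n]: the coefficient of [muni q] that carries the leading monomial is nonzero,
    hence nonzero at some [a]. Specializing at [a] leaves a nonzero polynomial in the last variable,
    which has a non-root. *)
Lemma mpoly_exists_nonzero (C : numFieldType) n (q : {mpoly C[n]}) :
  q != 0 -> exists a, q.@[a] != 0.
Proof.
elim: n q => [|n IH] q q0.
  exists (fun=> 0); rewrite (nvar0_mpolyC q) mevalC.
  by apply: contra q0 => /eqP e; rewrite (nvar0_mpolyC q) e mpolyC0.
have : q@_(mlead q) != 0 by rewrite mleadc_eq0.
rewrite -coef_muni => q1.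
have /IH[a ha] : (muni q)`_(mlead q ord_max) != 0.
  by apply: contra q1 => /eqP ->; rewrite mcoeff0.
have /poly_exists_nonroot[x hx] : map_poly (meval a) (muni q) != 0.
  by apply: contra ha => /eqP e; rewrite -coef_map e coef0.
pose v (j : 'I_n.+1) := if unlift ord_max j is Some j' then a j' else x.
exists v; rewrite meval_muni.
have -> : v ord_max = x by rewrite /v unlift_none.
rewrite (eq_map_poly (g := meval a)) // => p; apply: meval_eq => j.
rewrite /v; case: unliftP => [j' e|e].
  by congr a; apply/val_inj; move/(congr1 val): e; rewrite /= /bump leqNgt ltn_ord.
by move/(congr1 val)/eqP: e; rewrite /= ltn_eqF.
Qed.

(* If P A(a0) Q = 1, then det(P A Q) witnesses the lower bound on the rank. *)
Lemma rank_semicontinuous (C : fieldType) m N p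
    (A : 'M[{mpoly C[m]}]_(N, p)) (a0 : 'I_m -> C) :
  exists2 q : {mpoly C[m]}, q.@[a0] != 0 & forall a, q.@[a] != 0 ->
    (\rank (map_mx (meval a0) A) <= \rank (map_mx (meval a) A))%N.
Proof.
set A0 := map_mx _ A.
have /row_freeP[Q hQ] := row_base_free A0.
have /row_fullP[P hP] := col_base_full A0.
have ePQ : P *m A0 *m Q = 1%:M by rewrite -[X in P *m X *m _]mulmx_base mulmxA hP mul1mx.
pose B := map_mx (@mpolyC m C) P *m A *m map_mx (@mpolyC m C) Q.
have evB a : map_mx (meval a) B = P *m map_mx (meval a) A *m Q.
  rewrite !map_mxM -!map_mx_comp; congr (_ *m _ *m _);
    by apply/matrixP => j l; rewrite !mxE /= mevalC.
exists (\det B) => [|a]; rewrite -det_map_mx evB; first by rewrite ePQ det1 oner_eq0.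
rewrite -unitfE => u; have := mxrank_unit u => <-.
by rewrite -mulmxA (leq_trans (mxrankM_maxr _ _)) // mxrankM_maxl.
Qed.

Lemma dim_span_rank (C : fieldType) (V : vectType C) N (X : N.-tuple V) :
  \dim <<X>> = \rank (b2mx X).
Proof.
case: X => s sz; have e := eqP sz; subst N.
rewrite /dimv [span]unlock /= mx2vsK; congr (\rank (b2mx _)); exact: val_inj.
Qed.

(** In coordinates the vectors are the rows of a matrix with polynomial entries, to which
    [rank_semicontinuous] applies. *)
Lemma dim_span_semicontinuous (C : fieldType) (V : vectType C) m N (I : finType)
    (P : 'I_N -> I -> {mpoly C[m]}) (w : 'I_N -> I -> V) (a0 : 'I_m -> C) :
  exists2 q : {mpoly C[m]}, q.@[a0] != 0 & forall a, q.@[a] != 0 ->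
    (\dim <<[seq (\sum_l (P j l).@[a0] *: w j l)%R | j : 'I_N]>> <=
     \dim <<[seq (\sum_l (P j l).@[a] *: w j l)%R | j : 'I_N]>>)%N.
Proof.
pose A : 'M[{mpoly C[m]}]_(N, dim V) :=
  \matrix_(j, c) \sum_l (v2r (w j l) 0 c)%:MP * P j l.
have dimE a : \dim <<[seq (\sum_l (P j l).@[a] *: w j l)%R | j : 'I_N]>> =
    \rank (map_mx (meval a) A).
  have -> : [seq \sum_l (P j l).@[a] *: w j l | j : 'I_N]
    = [tuple \sum_l (P j l).@[a] *: w j l | j < N] by [].
  rewrite dim_span_rank; congr (\rank _); apply/matrixP => j c.
  rewrite !mxE tnth_mktuple raddf_sum summxE raddf_sum; apply: eq_bigr => l _ /=.
  by rewrite linearZ mxE mevalM mevalC mulrC.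
have [q q0 hq] := rank_semicontinuous A a0.
by exists q => // a /hq; rewrite !dimE.
Qed.

(** * Dimensions of orthogonals and of quotients *)

Lemma dim_ge_vspace (C : fieldType) (V : vectType C) (K : {vspace V}) q :
  dim_ge (fun v => v \in K) q <-> (q <= \dim K)%N.
Proof.
split=> [[X fX XK]|leq].
  by move: fX; rewrite /free size_tuple => /eqP <-; apply/dimvS/span_subvP.
have sz : size (take q (vbasis K)) == q by rewrite size_takel // size_tuple.
exists (Tuple sz) => [|v /mem_take /vbasis_mem //].
by apply: (@catl_free _ _ (drop q (vbasis K))); rewrite cat_take_drop (basis_free (vbasisP K)).
Qed.

Lemma eq_dim_ge (C : fieldType) (V : vectType C) (P Q : V -> Prop) q :
  (forall v, P v <-> Q v) -> dim_ge P q <-> dim_ge Q q.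
Proof. by move=> PQ; split=> -[X fX XP]; exists X => // v /XP /PQ. Qed.

(** The orthogonal of [S] is the kernel of the map [phi] that pairs with a basis of [S].
    Nondegeneracy makes [phi] surjective, and rank-nullity gives the dimension. *)
Lemma dim_ge_orthogonal (C : fieldType) (V : vectType C)
    (b : V -> V -> C) (S : {vspace V}) q :
  (forall g, linear_for *%R (b^~ g)) -> (forall f, linear_for *%R (b f)) ->
  (forall g, (forall f, b f g = 0) -> g = 0) ->
  dim_ge (fun f => forall g, g \in S -> b f g = 0) q <-> (q + \dim S <= \dim {:V})%N.
Proof.
move=> bl br nondeg.
pose bL g : {linear V -> C^o} := HB.pack (b^~ g) (GRing.isLinear.Build C V C^o _ _ (bl g)).
pose bR f : {linear V -> C^o} := HB.pack (b f) (GRing.isLinear.Build C V C^o _ _ (br f)).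
pose p := \dim S; pose u := vbasis S; pose e := vbasis {:V}.
pose phi0 f : 'rV[C]_p := \row_j b f (tnth u j).
have phi0l : linear phi0.
  by move=> c f g; apply/rowP => j; rewrite !mxE bl.
pose phi : 'Hom(V, 'rV[C]_p) := linfun (HB.pack_for {linear V -> 'rV[C]_p} phi0
  (GRing.isLinear.Build C V 'rV[C]_p _ _ phi0l)).
have phiE f : phi f = phi0 f by rewrite lfunE.
have kerE f : (f \in lker phi) <-> (forall g, g \in S -> b f g = 0).
  rewrite memv_ker phiE; split=> [/eqP e0 g gS|e0].
    rewrite (coord_vbasis gS) -[LHS]/(bR f _) linear_sum big1 // => j _.
    rewrite linearZ /=; move/rowP/(_ j): e0; rewrite !mxE (tnth_nth 0) => ->.
    by rewrite scaler0.
  by apply/eqP/rowP => j; rewrite !mxE e0 // vbasis_mem // mem_tnth.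
rewrite (eq_dim_ge _ (Q := fun f => f \in lker phi)); last by move=> v; rewrite kerE.
rewrite dim_ge_vspace.
have <- : (\dim (lker phi) + \dim S = \dim {:V})%N.
  rewrite -(limg_ker_dim phi {:V}) capfv; congr addn.
  suff -> : limg phi = fullv by rewrite dimvf /dim /= mul1n.
  pose Q : 'M[C]_(p, \dim {:V}) := \matrix_(j, l) b (tnth e l) (tnth u j).
  (* A relation between the rows of [Q] gives [g] in [S] orthogonal to everything, so [g = 0]. The
     columns of the right inverse [B] then give preimages of the unit vectors under [phi]. *)
  have /row_freeP[B QB] : row_free Q.
    apply: inj_row_free => c cQ; pose g := \sum_j c 0 j *: tnth u j.
    suff g0 : g = 0.
      apply/rowP => j; rewrite mxE; move: (basis_free (vbasisP S)) => /freeP; apply.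
      by rewrite -[RHS]g0; apply: eq_bigr => l _; rewrite (tnth_nth 0).
    apply: nondeg => f; rewrite (coord_vbasis (memvf f)) -[LHS]/(bL g _) linear_sum big1 // => l _.
    rewrite linearZ /= -[b _ _]/(bR _ g) linear_sum.
    move/rowP/(_ l): cQ; rewrite !mxE => cQ.
    suff -> : \sum_j bR e`_l (c 0 j *: tnth u j) = 0 by rewrite scaler0.
    rewrite -[RHS]cQ; apply: eq_bigr => j _; rewrite linearZ mxE /= /Q.
    by rewrite (tnth_nth 0 e).
  apply/vspaceP => r; rewrite memvf; apply/memv_imgP.
  exists (\sum_j r 0 j *: \sum_l B l j *: tnth e l); first exact: memvf.
  apply/rowP => j; rewrite phiE mxE -[b _ _]/(bL _ _) linear_sum (bigD1 j) //.
  have dE j' : bL (tnth u j) (\sum_l B l j' *: tnth e l) = (j == j')%:R.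
    move/matrixP/(_ j j'): QB; rewrite !mxE => <-; rewrite linear_sum.
    by apply: eq_bigr => l _; rewrite linearZ mxE mulrC.
  rewrite linearZ dE eqxx big1 => [|j' ne]; first exact/esym/(etrans (addr0 _))/mulr1.
  by rewrite linearZ dE eq_sym (negPf ne) [LHS]mulr0.
by rewrite leq_add2r.
Qed.

(** The span of the [H l] has dimension [q] and meets [J] only in 0, so its sum with [J] is direct
    inside [Z]. *)
Lemma free_modulo_dim (C : fieldType) (V : vectType C) (J Z : {vspace V}) q
    (H : 'I_q -> V) :
  (J <= Z)%VS -> (forall l, H l \in Z) ->
  (forall c : 'I_q -> C, \sum_l c l *: H l \in J -> forall l, c l = 0) ->
  (q + \dim J <= \dim Z)%N.
Proof.
move=> JZ HZ indep; pose X := [tuple H l | l < q].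
have XE c : \sum_(l < q) c l *: X`_l = \sum_l c l *: H l.
  by apply: eq_bigr => l _; rewrite -tnth_nth tnth_mktuple.
have fX : free X by apply/freeP => c; rewrite XE => e; apply: indep; rewrite e mem0v.
have <- : \dim <<X>> = q by move: fX; rewrite /free size_tuple => /eqP.
rewrite -dimv_disjoint_sum; last first.
  apply/eqP; rewrite -subv0; apply/subvP => v /memv_capP[/coord_span -> vJ].
  rewrite XE in vJ *; rewrite big1 ?mem0v // => l _.
  by rewrite (indep _ vJ) scale0r.
apply: dimvS; rewrite subv_add JZ andbT; apply/span_subvP => v /mapP[l _ ->].
exact: HZ.
Qed.

(** The vectors are taken from a basis of a complement of [J] in [Z]. *)
Lemma exists_free_modulo (C : fieldType) (V : vectType C) (J Z : {vspace V}) q :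
  (J <= Z)%VS -> (q + \dim J <= \dim Z)%N ->
  exists2 H : 'I_q -> V, forall l, H l \in Z &
    forall c : 'I_q -> C, \sum_l c l *: H l \in J -> forall l, c l = 0.
Proof.
move=> JZ leq; have : (q <= \dim (Z :\: J))%N.
  by rewrite -(leq_add2r (\dim J)) (leq_trans leq) // -(dimv_cap_compl Z J) (capv_idPr JZ) addnC.
case/dim_ge_vspace => X /freeP fX XZ; exists (fun l => tnth X l) => [l|c cJ].
  by apply: (subvP (diffvSl Z J)); apply/XZ/mem_tnth.
apply: fX; apply/eqP; rewrite -memv0 -(capv_diff Z J) memv_cap.
under eq_bigr do rewrite -tnth_nth.
by rewrite cJ andbT; apply: memv_suml => l _; apply/memvZ/XZ/mem_tnth.
Qed.

(** * Apolarity *)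

Lemma dhomog_mderivm (R : comNzRingType) n D (p : {mpoly R[n]}) (m : 'X_{1..n}) :
  p \is D.-homog -> p^`M[m] \is (D - mdeg m).-homog.
Proof.
move=> hp; apply/dhomogP => m'; rewrite mcoeff_msupp mcoeff_mderivm => ne.
have /(dhomog_mf hp) /= <- : (m + m')%MM \in msupp p.
  by rewrite mcoeff_msupp; apply: contra ne => /eqP ->; rewrite mul0rn.
by rewrite mdegD addKn.
Qed.

Lemma dhomog0_const (R : comNzRingType) n (p : {mpoly R[n]}) :
  p \is 0.-homog -> p = (p@_0%MM)%:MP.
Proof.
move=> hp; apply/mpolyP => m; rewrite mcoeffC.
have [->|ne] := eqVneq m 0%MM; first by rewrite mulr1.
by rewrite mulr0 (dhomog_nemf_coeff hp) //= mdeg_eq0.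
Qed.

Lemma dhomog1_sum (R : comNzRingType) n (L : {mpoly R[n]}) :
  L \is 1.-homog -> L = \sum_j L@_U_(j) *: 'X_j.
Proof.
move=> hL; apply/mpolyP => m; rewrite raddf_sum /=.
have [/mdeg1P[j /eqP ->]|ne] := boolP (mdeg m == 1%N).
  rewrite (bigD1 j) //= mcoeffZ mcoeffX eqxx mulr1 big1 ?addr0 // => l lj.
  by rewrite mcoeffZ mcoeffX eq_mnm1 (negPf lj) mulr0.
rewrite (dhomog_nemf_coeff hL) // big1 // => j _; rewrite mcoeffZ mcoeffX.
by have [e|_] := eqVneq U_(j)%MM m; [rewrite -e mdeg1 in ne | rewrite mulr0].
Qed.

Lemma dhomog1_exp (R : comNzRingType) n k (L : {mpoly R[n]}) :
  L \is 1.-homog -> L ^+ k \is k.-homog.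
Proof. by move=> hL; have := dhomogMn k hL; rewrite mul1n. Qed.

(** Both sides are additive in [h]; on a monomial the exponents sum to [e]. *)
Lemma euler_identity (R : comNzRingType) n e (h : {mpoly R[n]}) (a : 'I_n -> R) :
  h \is e.-homog -> \sum_j a j * (h^`M(j)).@[a] = e%:R * h.@[a].
Proof.
move=> hh.
have hE j : (h^`M(j)).@[a] = \sum_(m <- msupp h) h@_m * ('X_[m]^`M(j)).@[a].
  rewrite {1}[h]mpolyE (raddf_sum (mderiv j)) (raddf_sum (meval a)) /=; apply: eq_bigr => m _.
  by rewrite mderivZ mevalZ.
rewrite [h in RHS]mpolyE raddf_sum mulr_sumr /=.
under eq_bigr => j _ do rewrite hE mulr_sumr.
rewrite exchange_big /= big_seq [RHS]big_seq; apply: eq_bigr => m hm.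
rewrite -(dhomog_mf hh hm) /= mdegE natr_sum mulr_suml; apply: eq_bigr => j _.
rewrite mderivX !mevalZ.
(* The subtraction [m - U_(j)] is truncated, so the exponent 0 is treated apart. *)
have [->|mj] := eqVneq (m j) 0%N; first by rewrite !(mul0r, mulr0).
have -> : 'X_[R, m] = 'X_[m - U_(j)] * 'X_j by rewrite -mpolyXD submK // lep1mP.
by rewrite mevalM mevalXU; ring.
Qed.

(** An index set independent of [f] lets the actions of different operators be added term by
    term. *)
Lemma diff_actionwE (C : fieldType) n k (f p : {mpoly C[n.+1]}) : (msize f <= k)%N ->
  diff_action f p = \sum_(m : 'X_{1..n.+1 < k}) f@_m *: p^`M[m].
Proof.
move=> lek; set I : subFinType _ := 'X_{1..n.+1 < k}.
rewrite /diff_action (big_mksub I) ?msupp_uniq //=; last first.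
  by move=> x /msize_mdeg_lt /leq_trans; apply.
by rewrite big_rmcond //= => j /memN_msupp_eq0 ->; rewrite scale0r.
Qed.

Lemma diff_action_linearl (C : fieldType) n (p : {mpoly C[n.+1]}) :
  linear (fun f : {mpoly C[n.+1]} => diff_action f p).
Proof.
move=> c f g /=; pose k := maxn (msize (c *: f + g)) (maxn (msize f) (msize g)).
rewrite !(@diff_actionwE _ _ k) ?leq_max ?leqnn ?orbT // scaler_sumr -big_split /=.
by apply: eq_bigr => m _; rewrite mcoeffD mcoeffZ scalerDl scalerA.
Qed.

Lemma diff_action_linearr (C : fieldType) n (f : {mpoly C[n.+1]}) :
  linear (@diff_action C n f).
Proof.
move=> c p q /=; rewrite /diff_action scaler_sumr -big_split /=.
by apply: eq_bigr => m _; rewrite mderivmD mderivmZ scalerDr !scalerA mulrC.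
Qed.

HB.instance Definition _ (C : fieldType) n (f : {mpoly C[n.+1]}) :=
  GRing.isLinear.Build C {mpoly C[n.+1]} {mpoly C[n.+1]} _ (@diff_action C n f)
    (@diff_action_linearr C n f).

Lemma diff_action_suml (C : fieldType) n (I : Type) (s : seq I) (c : I -> C)
    (f : I -> {mpoly C[n.+1]}) p :
  diff_action (\sum_(j <- s) c j *: f j) p = \sum_(j <- s) c j *: diff_action (f j) p.
Proof.
elim: s => [|j s IH]; last by rewrite !big_cons diff_action_linearl IH.
by rewrite !big_nil /diff_action msupp0 big_nil.
Qed.

Lemma diff_actionX (C : fieldType) n m (p : {mpoly C[n.+1]}) :
  diff_action 'X_[m] p = p^`M[m].
Proof. by rewrite /diff_action msuppX big_seq1 mcoeffX eqxx scale1r. Qed.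

(** By linearity this reduces to monomials, where it is the composition of partial derivatives. *)
Lemma diff_actionM (C : fieldType) n (f g p : {mpoly C[n.+1]}) :
  diff_action (f * g) p = diff_action g (diff_action f p).
Proof.
rewrite [f]mpolyE mulr_suml.
have XM m : diff_action ('X_[m] * g) p = diff_action g p^`M[m].
  rewrite [g]mpolyE mulr_sumr; under eq_bigr => l _ do rewrite -scalerAr -mpolyXD.
  rewrite !diff_action_suml; apply: eq_bigr => l _.
  by rewrite !diff_actionX mderivmDm.
under eq_bigr => m _ do rewrite -scalerAl.
rewrite !diff_action_suml raddf_sum; apply: eq_bigr => m _ /=.
by rewrite linearZ /= XM diff_actionX.
Qed.

(** One application of [L] is the derivative along the dual point. By Euler's identity its value at
    that point is the degree times the value of [h], and the degrees multiply up to the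
    factorial. *)
Lemma diff_action_exp (C : fieldType) n e (L h : {mpoly C[n.+1]}) :
  L \is 1.-homog -> h \is e.-homog ->
  diff_action (L ^+ e) h = (e`!%:R * h.@[dual_point L])%:MP.
Proof.
move=> hL; elim: e h => [|e IH] h hh.
  by rewrite expr0 -mpolyX0 diff_actionX mderivm0m mul1r [h]dhomog0_const // mevalC.
have hd j : h^`M(j) \is e.-homog.
  by have := dhomog_mderivm U_(j) hh; rewrite mderivmU1m mdeg1 subn1.
have actL : diff_action L h = \sum_j L@_U_(j) *: h^`M(j).
  rewrite [L in LHS](dhomog1_sum hL) diff_action_suml.
  by apply: eq_bigr => j _; rewrite diff_actionX mderivmU1m.
rewrite exprS diff_actionM actL IH; last by apply: rpred_sum => j _; apply/rpredZ/hd.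
rewrite (raddf_sum (meval _)) /=.
rewrite (eq_bigr (fun j => dual_point L j * (h^`M(j)).@[dual_point L])) => [|j _];
  last exact: mevalZ.
by rewrite (euler_identity _ hh) mulrA -natrM factS [(e.+1 * _)%N]mulnC.
Qed.

Lemma dhomog_msize_le (R : comNzRingType) n D (p : {mpoly R[n]}) :
  p \is D.-homog -> (msize p <= D.+1)%N.
Proof.
by move=> hp; rewrite msizeE; apply/bigmax_leqP_seq => m /(dhomog_mf hp) /= ->.
Qed.

(** On forms of equal degree the action is a scalar pairing, diagonal in the monomials with products
    of factorials as entries. Its symmetry is then visible. *)
Lemma diff_action_dhomog (C : fieldType) n D (f g : {mpoly C[n.+1]}) :
  f \is D.-homog -> g \is D.-homog ->
  diff_action f g = (\sum_(m : 'X_{1..n.+1 < D.+1})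
     f@_m * g@_m *+ \prod_(j < n.+1) (m j)`!)%:MP.
Proof.
move=> hf hg; rewrite (diff_actionwE _ (dhomog_msize_le hf)) raddf_sum.
apply: eq_bigr => m _ /=.
have [e|ne] := eqVneq (mdeg m) D; last first.
  by rewrite (dhomog_nemf_coeff hf) // scale0r mul0r mul0rn mpolyC0.
rewrite [_^`M[m]]dhomog0_const; last by have := dhomog_mderivm m hg; rewrite e subnn.
rewrite mcoeff_mderivm addm0 -mul_mpolyC -mpolyCM mulrnAr.
by congr (_ *+ _)%:MP; apply: eq_bigr => j _; rewrite ffactnn.
Qed.

Lemma diff_action_sym (C : fieldType) n D (f g : {mpoly C[n.+1]}) :
  f \is D.-homog -> g \is D.-homog -> diff_action f g = diff_action g f.
Proof.
move=> hf hg; rewrite (diff_action_dhomog hf hg) (diff_action_dhomog hg hf).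
by congr _%:MP; apply: eq_bigr => m _; rewrite mulrC.
Qed.

(** Pairing with the monomial [m] returns the coefficient of [g] at [m] times factorials, which are
    nonzero in characteristic 0. *)
Lemma diff_action_nondegenerate (C : numFieldType) n D (g : {mpoly C[n.+1]}) :
  g \is D.-homog -> (forall f, f \is D.-homog -> diff_action f g = 0) -> g = 0.
Proof.
move=> hg orth; apply/mpolyP => m; rewrite mcoeff0.
have [e|ne] := eqVneq (mdeg m) D; last by rewrite (dhomog_nemf_coeff hg).
have /orth : 'X_[m] \is [in C[n.+1], D.-homog] by rewrite dhomogX /= e.
rewrite diff_actionX => /(congr1 (mcoeff 0%MM)).
rewrite mcoeff_mderivm addm0 mcoeff0 => /eqP; rewrite mulrn_eq0 => /orP[|/eqP //].
by rewrite eqn0Ngt prodn_gt0 // => j; rewrite ffactnn fact_gt0.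
Qed.

(** Pairing [f] with [L ^+ k * 'X_[al]] gives, up to [k!], the value at the dual point of the
    derivative of [f] along [al]. Orthogonality thus says that the derivatives of order exactly [m]
    vanish there; Euler's identity passes this down to lower orders. *)
Lemma multiplicity_geP (C : numFieldType) n m k (L f : {mpoly C[n.+1]}) :
  L \is 1.-homog -> f \is (m + k).-homog -> (0 < k)%N ->
  multiplicity_ge (m%:Z + 1) (dual_point L) f <->
  forall p, p \is m.-homog -> diff_action f (L ^+ k * p) = 0.
Proof.
move=> hL hf k0.
have actE al : mdeg al = m ->
    diff_action f (L ^+ k * 'X_[al]) = (k`!%:R * (f^`M[al]).@[dual_point L])%:MP.
  move=> eal; rewrite (diff_action_sym hf); last first.
    by rewrite addnC; apply: dhomogM; rewrite ?dhomogX /= ?eal //; apply: dhomog1_exp.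
  rewrite mulrC diff_actionM diff_actionX diff_action_exp //.
  by have := dhomog_mderivm al hf; rewrite eal addKn.
split=> [mult p hp|orth].
  rewrite [p]mpolyE mulr_sumr raddf_sum big_seq big1 //= => al hal.
  have e := dhomog_mf hp hal.
  by rewrite -scalerAr linearZ /= actE // mult ?mulr0 ?scaler0 // e ltzD1.
suff top j al : (mdeg al + j = m)%N -> (f^`M[al]).@[dual_point L] = 0.
  by move=> al; rewrite ltzD1 lez_nat => /subnKC; apply: top.
(* Here [j] is the distance from the order of [al] to the top order [m]. *)
elim: j al => [|j IH] al eal.
  have := actE al; rewrite -[mdeg al]addn0 eal => /(_ erefl).
  rewrite orth; last by rewrite dhomogX /= -eal addn0.
  move/esym/eqP; rewrite mpolyC_eq0 mulf_eq0 pnatr_eq0 -leqn0 leqNgt fact_gt0.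
  by move/eqP.
(* The derivatives of the next order vanish, and the degree of this one is positive because
   [k > 0]. *)
have := euler_identity (dual_point L) (dhomog_mderivm al hf).
rewrite big1 => [/esym/eqP|l _]; last first.
  rewrite -mderivmU1m -mderivmDm IH ?mulr0 //.
  by rewrite mdegD mdeg1 -eal addn1 addSnnS.
rewrite mulf_eq0 pnatr_eq0 subn_eq0 -eal -addnA leqNgt -addn1 leq_add2l addn_gt0 k0 orbT.
by move/eqP.
Qed.

(** * Osculating spaces of the Veronese variety *)

(** Linear on all polynomials, which [indhomog] is not; the two agree on forms of degree [D]. *)
Definition hproj (C : fieldType) n D (p : {mpoly C[n.+1]}) : dhomog n.+1 C D :=
  DHomog (pihomogP mdeg D p).

Lemma hproj_is_linear (C : fieldType) n D : linear (@hproj C n D).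
Proof. by move=> c p q; apply: val_inj; rewrite /= linearP. Qed.

HB.instance Definition _ (C : fieldType) n D :=
  GRing.isLinear.Build C {mpoly C[n.+1]} (dhomog n.+1 C D) _ (@hproj C n D)
    (@hproj_is_linear C n D).

Lemma hprojK (C : fieldType) n D (p : {mpoly C[n.+1]}) :
  p \is D.-homog -> hproj D p = p :> {mpoly C[n.+1]}.
Proof. exact: pihomog_dE. Qed.

Lemma indhomog_hproj (C : fieldType) n D (p : {mpoly C[n.+1]}) :
  p \is D.-homog -> indhomog D p = hproj D p.
Proof.
by move=> hp; apply: val_inj; rewrite /= (pihomog_dE hp) /indhomog val_insubd hp.
Qed.

Arguments hproj : simpl never.

(** The target degree [D] is a separate parameter, so that it can be [d + i] as well as [m + k]
    without a cast between types. *)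
Definition mul_power (C : fieldType) n m D k (L : {mpoly C[n.+1]})
    (p : dhomog n.+1 C m) : dhomog n.+1 C D :=
  hproj D (L ^+ k * p).

Lemma mul_power_is_linear (C : fieldType) n m D k (L : {mpoly C[n.+1]}) :
  linear (@mul_power C n m D k L).
Proof. by move=> c p q; rewrite /mul_power /= mulrDr -scalerAr linearP. Qed.

HB.instance Definition _ (C : fieldType) n m D k (L : {mpoly C[n.+1]}) :=
  GRing.isLinear.Build C (dhomog n.+1 C m) (dhomog n.+1 C D) _
    (@mul_power C n m D k L) (@mul_power_is_linear C n m D k L).

(* The degree-D part of L^k R. *)
Definition power_part (C : fieldType) n m D k (L : {mpoly C[n.+1]}) :
    {vspace dhomog n.+1 C D} :=
  limg (linfun (@mul_power C n m D k L)).

Lemma mem_power_part (C : fieldType) n m D k (L p : {mpoly C[n.+1]}) :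
  p \is m.-homog -> hproj D (L ^+ k * p) \in power_part m D k L.
Proof.
move=> hp; have -> : hproj D (L ^+ k * p) = linfun (@mul_power C n m D k L) (hproj m p).
  by rewrite lfunE /= /mul_power hprojK.
exact/memv_img/memvf.
Qed.

Lemma power_partP (C : fieldType) n m D k (L : {mpoly C[n.+1]}) (S : {vspace _}) :
  (forall al, mdeg al = m -> hproj D (L ^+ k * 'X_[al]) \in S) ->
  (power_part m D k L <= S)%VS.
Proof.
move=> XS; apply/subvP => _ /memv_imgP[p _ ->]; rewrite lfunE /= /mul_power.
rewrite [X in L ^+ k * X]mpolyE mulr_sumr raddf_sum big_seq rpred_sum // => al hal /=.
by rewrite -scalerAr linearZ memvZ // XS // (dhomog_mf (dhomog_is_dhomog p) hal).
Qed.

Lemma lker_linear_projection (C : fieldType) (V : vectType C) (U : {vspace V}) :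
  lker (linear_projection U) = U.
Proof.
apply/vspaceP => v; rewrite memv_ker /linear_projection.
have d0 : (U^C :&: U = 0)%VS by rewrite capvC capv_compl.
have vUU : v \in (U^C + U)%VS by rewrite addvC addv_complf memvf.
have addE := daddv_pi_add d0 vUU.
apply/eqP/idP => [e|vU]; first by move: addE; rewrite e add0r => <-; apply: memv_pi.
by apply: (addIr v); rewrite add0r -[RHS]addE (daddv_pi_id (capv_compl U) vU).
Qed.

(** The projection restricted to [S] has kernel [S :&: U]. *)
Lemma dim_linear_projection (C : fieldType) (V : vectType C) (U S : {vspace V}) :
  (\dim (linear_projection U @: S) + \dim U = \dim (S + U))%N.
Proof.
have := dimv_sum_cap S U; have := limg_ker_dim (linear_projection U) S.
rewrite lker_linear_projection => <-.
by move=> h; apply/eqP; rewrite -(eqn_add2r (\dim (S :&: U))) h addnC addnA.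
Qed.

(** The form whose powers are expanded in [veronese]: a polynomial in the chart coordinates with
    coefficients in R. *)
Definition generic_form (C : fieldType) n : {mpoly {mpoly C[n.+1]}[n]} :=
  ('X_ord0)%:MP_[n] + \sum_(j < n) ('X_(lift ord0 j))%:MP_[n] * 'X_j.

Definition chart (C : fieldType) n (t : 'I_n -> C) : {mpoly C[n.+1]} :=
  'X_ord0 + \sum_(j < n) t j *: 'X_(lift ord0 j).

Lemma chart_homog (C : fieldType) n (t : 'I_n -> C) : chart t \is 1.-homog.
Proof.
apply: rpredD; first by rewrite dhomogX /= mdeg1.
by apply: rpred_sum => j _; apply: rpredZ; rewrite dhomogX /= mdeg1.
Qed.

Lemma meval_generic_form (C : fieldType) n (t : 'I_n -> C) :
  (generic_form C n).@[fun j => (t j)%:MP] = chart t.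
Proof.
rewrite /generic_form mevalD mevalC (raddf_sum (meval _)); congr (_ + _).
by apply: eq_bigr => j _ /=; rewrite mevalM mevalC mevalXU mulrC mul_mpolyC.
Qed.

Lemma coef_generic_form (C : fieldType) n (be : 'X_{1..n}) :
  (generic_form C n)@_be = 'X_ord0 * (be == 0%MM)%:R
    + \sum_(j < n) 'X_(lift ord0 j) * (U_(j)%MM == be)%:R.
Proof.
rewrite mcoeffD mcoeffC (raddf_sum (mcoeff be)); congr (_ + _).
by apply: eq_bigr => j _ /=; rewrite mcoeffCM mcoeffX.
Qed.

Lemma coef_generic_form_homog (C : fieldType) n e be :
  (generic_form C n ^+ e)@_be \is e.-homog.
Proof.
elim: e be => [|e IH] be.
  by rewrite expr0 mcoeff1; case: eqP => _; rewrite ?dhomog1 ?dhomog0.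
rewrite exprS mcoeffM; apply: rpred_sum => q _; rewrite -[e.+1]add1n; apply: dhomogM => //.
have natP (x : {mpoly C[n.+1]}) (b : bool) : x \is 1.-homog -> x * b%:R \is 1.-homog.
  by case: b => hx; rewrite ?mulr1 // mulr0 dhomog0.
rewrite coef_generic_form; apply: rpredD; first by apply: natP; rewrite dhomogX /= mdeg1.
by apply: rpred_sum => j _; apply: natP; rewrite dhomogX /= mdeg1.
Qed.

(** Guarantees that the bound [D.+1] on the exponents in [veronese] cuts off no term. *)
Lemma msize_generic_form (C : fieldType) n e : (msize (generic_form C n ^+ e) <= e.+1)%N.
Proof.
rewrite msizeE; apply/bigmax_leqP_seq => be hbe _; rewrite ltnS.
apply: leq_trans (lemc_mdeg (msupp_le_mlead hbe)) _.
apply: leq_trans (lemc_mdeg (mleadX_le _ _)) _.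
rewrite mdegMn -{2}(mul1n e) leq_mul2r; apply/orP; right.
have [->|] := eqVneq (generic_form C n) 0; first by rewrite mlead0 mdeg0.
rewrite -mleadc_eq0; apply: contraNT; rewrite -ltnNge => gt1.
rewrite coef_generic_form; have /negPf -> : mlead (generic_form C n) != 0%MM.
  by rewrite -mdeg_eq0 -lt0n (ltn_trans _ gt1).
rewrite mulr0 add0r big1 // => j _; case: eqP => [e1|]; last by rewrite mulr0.
by rewrite -e1 mdeg1 in gt1.
Qed.

Lemma mderiv_exp (R : comNzRingType) n (j : 'I_n) (p : {mpoly R[n]}) e :
  (p ^+ e)^`M(j) = (p ^+ e.-1 * p^`M(j)) *+ e.
Proof.
elim: e => [|[|e] IH]; first by rewrite expr0 mulr0n -mpolyC1 mderivC.
  by rewrite expr1 expr0 mul1r.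
rewrite exprS mderivM IH [RHS]mulrS; congr (_ + _); first exact: mulrC.
by rewrite mulrnAr mulrA -exprS.
Qed.

Lemma mderiv_generic_form (C : fieldType) n j e :
  (generic_form C n ^+ e)^`M(j) =
    (generic_form C n ^+ e.-1 * ('X_(lift ord0 j))%:MP_[n]) *+ e.
Proof.
have d1 : (generic_form C n)^`M(j) = ('X_(lift ord0 j))%:MP_[n].
  rewrite /generic_form mderivD mderivC add0r (raddf_sum (mderiv j)) (bigD1 j) //=.
  rewrite mderiv_mulC mderivX mnm1E eqxx scale1r -{1}(add0m U_(j)%MM) addmK mpolyX0 mulr1.
  rewrite big1 ?addr0 // => l lj.
  by rewrite mderiv_mulC mderivX mnm1E (negPf lj) scale0r mulr0.
by rewrite mderiv_exp d1.
Qed.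

(** Each derivative lowers the power by one and brings out a variable. Beyond order [e] the falling
    factorial is 0, so the truncated exponent does no harm. *)
Lemma mderivm_generic_form (C : fieldType) n (al : 'X_{1..n}) e :
  (generic_form C n ^+ e)^`M[al] =
    (generic_form C n ^+ (e - mdeg al)
       * (mmap1 (fun j => 'X_(lift ord0 j)) al)%:MP_[n]) *+ e ^_ (mdeg al).
Proof.
have [s es] : exists s, mdeg al = s by exists (mdeg al).
elim: s al es => [|s IH] al es.
  move/eqP: (es); rewrite mdeg_eq0 => /eqP ->.
  by rewrite mderivm0m mdeg0 subn0 ffactn0 mulr1n mmap11 mpolyC1 mulr1.
have [j hj] : exists j, al j != 0%N.
  apply/existsP; apply: contraT; rewrite negb_exists => /forallP h.
  move: es; rewrite mdegE big1 // => j _; apply/eqP; move: (h j); by rewrite negbK.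
have eal : (al - U_(j) + U_(j))%MM = al by rewrite submK // lep1mP.
have es' : mdeg (al - U_(j))%MM = s.
  by move: es; rewrite -{1}eal mdegD mdeg1 addn1 => -[].
rewrite -eal mderivmDm IH // mderivmU1m mderivMn mulrC mderiv_mulC mderiv_generic_form.
rewrite mdegD mdeg1 es' addn1 ffactnSr subnS mulrnA mulrnAC.
rewrite commr_mmap1_M; last by move=> *; apply: mulrC.
by rewrite mmap1U mulrnAr [in RHS]mpolyCM mulrCA.
Qed.

Lemma partial_at_veronese (C : fieldType) n D (al : 'X_{1..n}) (t : 'I_n -> C) :
  partial_at (@veronese C n D) al t =
    hproj D (chart t ^+ (D - mdeg al) * mmap1 (fun j => 'X_(lift ord0 j)) al)
      *+ D ^_ (mdeg al).
Proof.
(* The sum defining [partial_at] is the monomial expansion of the derivative of the whole power,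
   evaluated at constants. *)
have -> : partial_at (@veronese C n D) al t =
    hproj D ((generic_form C n ^+ D)^`M[al]).@[fun j => (t j)%:MP].
  rewrite [X in X^`M[_]](mpolywE (msize_generic_form C n D)).
  rewrite (raddf_sum (mderivm al)) (raddf_sum (meval _)) raddf_sum.
  apply: eq_bigr => be _ /=; rewrite mderivmZ mevalZ.
  rewrite /veronese -/(generic_form C n) indhomog_hproj ?coef_generic_form_homog //.
  rewrite -linearZ !mderivmX !mevalZ !mevalX /=; congr hproj.
  rewrite mulrC -mul_mpolyC rmorphM rmorph_prod rmorph_nat.
  rewrite [RHS]mulrC; congr (_ * _); rewrite mulrC; congr (_ * _).
  by apply: eq_bigr => j _; rewrite rmorphXn.
rewrite mderivm_generic_form mevalMn mevalM rmorphXn /= meval_generic_form mevalC.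
by rewrite raddfMn.
Qed.

(** Up to a falling factorial, nonzero in characteristic 0, the derivatives are [chart t ^+ k] times
    products of a power of [chart t] and a monomial without ['X_ord0]. Such products of degree [m]
    span R_m, as [chart t] can replace ['X_ord0] as a coordinate. *)
Lemma span_power_part_chart (C : numFieldType) n m k (t : 'I_n -> C)
    (S : {vspace dhomog n.+1 C (m + k)}) :
  (forall al : 'X_{1..n}, (mdeg al <= m)%N -> partial_at (@veronese C n (m + k)) al t \in S) ->
  (power_part m (m + k) k (chart t) <= S)%VS.
Proof.
move=> hS; pose x := mmap1 (fun j : 'I_n => 'X_(lift ord0 j) : {mpoly C[n.+1]}).
have xD al j : x (al + U_(j))%MM = x al * 'X_(lift ord0 j).
  by rewrite /x commr_mmap1_M ?mmap1U // => *; apply: mulrC.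
(* induction on the power of x_0, through x_0 = chart t - sum_j t_j x_j *)
have key a ga c : (a + mdeg ga + c)%N = m ->
    hproj (m + k) (chart t ^+ k * ('X_ord0 ^+ a * x ga * chart t ^+ c)) \in S.
  elim: a ga c => [|a IH] ga c em.
    have le : (mdeg ga <= m)%N by rewrite -em leq_addr.
    have := hS ga le; rewrite partial_at_veronese -scaler_nat.
    have ec : (m + k - mdeg ga = k + c)%N by rewrite -em add0n -addnA addKn addnC.
    move=> /(memvZ ((m + k) ^_ (mdeg ga))%:R^-1); rewrite scalerA mulVf ?scale1r; last first.
      by rewrite pnatr_eq0 -lt0n ffact_gt0 (leq_trans le) // leq_addr.
    by rewrite ec exprD expr0 mul1r -mulrA [_ ^+ c * _]mulrC.
  have -> : chart t ^+ k * ('X_ord0 ^+ a.+1 * x ga * chart t ^+ c) =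
      chart t ^+ k * ('X_ord0 ^+ a * x ga * chart t ^+ c.+1)
      - \sum_j t j *: (chart t ^+ k * ('X_ord0 ^+ a * x (ga + U_(j))%MM * chart t ^+ c)).
    rewrite [in X in _ - X](eq_bigr (fun j => chart t ^+ k * ('X_ord0 ^+ a * x ga * chart t ^+ c)
        * (t j *: 'X_(lift ord0 j)))); last first.
      by move=> j _; rewrite xD -!scalerAr; congr (_ *: _); ring.
    have ->: 'X_ord0 ^+ a.+1 = 'X_ord0 ^+ a * (chart t - \sum_(j < n) t j *: 'X_(lift ord0 j)).
      by rewrite /chart addrK exprSr.
    by rewrite -mulr_sumr exprS; ring.
  rewrite raddfB raddf_sum; apply: rpredB; first by apply: IH; rewrite -em addnS !addSn.
  apply: rpred_sum => j _ /=; rewrite linearZ; apply/memvZ/IH.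
  by rewrite mdegD mdeg1 -em !addSn -addnA addnA addn1 !addnS addSn.
apply: power_partP => al eal.
pose ga := [multinom al (lift ord0 j) | j < n].
have -> : 'X_[C, al] = 'X_ord0 ^+ al ord0 * x ga * chart t ^+ 0.
  rewrite expr0 mulr1 mpolyXE_id big_ord_recl; congr (_ * _).
  by apply: eq_bigr => j _; rewrite mnmE.
apply: key; rewrite addn0 -eal !mdegE big_ord_recl; congr addn.
by apply: eq_bigr => j _; rewrite mnmE.
Qed.

(** The projection is linear, so it commutes with derivatives and spans; what remains is to identify
    the osculating space of the Veronese variety itself. *)
Lemma osculating_projected_veronese (C : numFieldType) n m k D
    (U : {vspace dhomog n.+1 C D}) (t : 'I_n -> C) :
  D = (m + k)%N ->
  osculating (projected_veronese U) m t =
    (linear_projection U @: power_part m D k (chart t))%VS.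
Proof.
move=> eD; subst D.
have partE al : partial_at (projected_veronese U) al t =
    linear_projection U (partial_at (@veronese C n (m + k)) al t).
  by rewrite /partial_at raddf_sum; apply: eq_bigr => be _ /=; rewrite linearZ.
have -> : osculating (projected_veronese U) m t = (linear_projection U @:
    <<[seq partial_at (@veronese C n (m + k)) al t | al : 'X_{1..n < m.+1}]>>)%VS.
  by rewrite limg_span -map_comp; congr span; apply: eq_map => al; apply: partE.
congr (_ @: _)%VS; apply/eqP; rewrite eqEsubv; apply/andP; split.
  apply/span_subvP => _ /mapP[al _ ->].
  have le : (mdeg al <= m)%N by rewrite -ltnS bmdeg.
  (* A derivative of order at most [m] keeps the factor [chart t ^+ k]. *)
  rewrite partial_at_veronese rpredMn // addnC -addnBA // exprD -mulrA addnC.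
  apply: mem_power_part; rewrite -[X in _ \is X.-homog](subnK le); apply: dhomogM.
    exact/dhomog1_exp/chart_homog.
  suff -> : mmap1 (fun j : 'I_n => 'X_(lift ord0 j)) al = 'X_[C, \sum_j U_(lift ord0 j) *+ al j].
    by rewrite dhomogX /= mdeg_sum mdegE; apply/eqP/eq_bigr => j _; rewrite mdegMn mdeg1 mul1n.
  by rewrite -mprodXnE.
apply: span_power_part_chart => al le; apply/memv_span/mapP.
have lt : (mdeg al < m.+1)%N by [].
by exists (BMultinom lt); rewrite ?mem_enum.
Qed.

(** * Homogeneous parts of the ideal *)

Lemma mem_ideal_part (C : fieldType) n r d t (F : 'I_r -> dhomog n.+1 C d)
    (p : dhomog n.+1 C (d + t)) :
  p \in ideal_part F t <->
  exists G : 'I_r -> dhomog n.+1 C t,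
    p = \sum_j (G j : {mpoly C[n.+1]}) * F j :> {mpoly C[n.+1]}.
Proof.
pose f j := linfun (@mul_form C n d t (F j)).
have fE j G : f j G = (G : {mpoly C[n.+1]}) * F j :> {mpoly C[n.+1]}.
  by rewrite lfunE /= mulrC.
split=> [/memv_sumP[vs vsU ->]|[G pG]].
  exists (fun j => (f j)^-1%VF (vs j)); rewrite raddf_sum; apply: eq_bigr => j _ /=.
  by rewrite -fE limg_lfunVK // vsU.
have -> : p = \sum_j f j (G j).
  by apply: val_inj; rewrite /= pG raddf_sum; apply: eq_bigr => j _; rewrite /= fE.
by apply: memv_sumr => j _; apply/memv_img/memvf.
Qed.

(** Without syzygies the multiplications by the [F j] are injective and their images are in direct
    sum. *)
Lemma dim_ideal_part (C : fieldType) n r d t (F : 'I_r -> dhomog n.+1 C d) :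
  no_syzygy F t -> \dim (ideal_part F t) = (r * \dim {:dhomog n.+1 C t})%N.
Proof.
move=> nosyz; pose f j := linfun (@mul_form C n d t (F j)).
have fE j G : f j G = (G : {mpoly C[n.+1]}) * F j :> {mpoly C[n.+1]}.
  by rewrite lfunE /= mulrC.
have sum0 (G : 'I_r -> dhomog n.+1 C t) : \sum_j f j (G j) = 0 -> forall j, G j = 0.
  move=> /(congr1 val) /= e; apply: nosyz; rewrite -[RHS]e raddf_sum.
  by apply: eq_bigr => j _; rewrite /= fE.
have -> : \dim (ideal_part F t) = (\sum_(j < r) \dim (limg (f j)))%N.
  apply/directvP/directv_sum_independent => us usU us0 j _.
  have usE l : us l = f l ((f l)^-1%VF (us l)) by rewrite limg_lfunVK // usU.
  rewrite usE (sum0 (fun l => (f l)^-1%VF (us l))) ?linear0 //.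
  by rewrite -[RHS]us0; apply: eq_bigr => l _; rewrite -usE.
rewrite (eq_bigr (fun=> \dim {:dhomog n.+1 C t})) => [|j _].
  by rewrite sum_nat_const card_ord.
apply: limg_dim_eq; rewrite capfv; apply/eqP/lker0P => x y fxy.
(* A vector supported at [j] alone turns the absence of syzygies into injectivity of [f j]. *)
pose G l : dhomog n.+1 C t := if l == j then x - y else 0.
have := sum0 G; rewrite (bigD1 j) //= big1 => [|l lj]; last first.
  by rewrite /G (negPf lj) linear0.
rewrite /G eqxx linearB /= fxy subrr addr0 => /(_ erefl j).
by rewrite eqxx => /eqP; rewrite subr_eq0 => /eqP.
Qed.

Lemma pihomogMr (R : comNzRingType) n d t (G F : {mpoly R[n]}) :
  F \is d.-homog -> pihomog mdeg (d + t) (G * F) = pihomog mdeg t G * F.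
Proof.
move=> hF; rewrite [G]mpolyE mulr_suml !raddf_sum mulr_suml; apply: eq_bigr => m _ /=.
rewrite -scalerAl !linearZ /= -scalerAl; congr (_ *: _).
have hX : 'X_[m] * F \is (mdeg m + d).-homog by apply: dhomogM; rewrite ?dhomogX.
rewrite pihomogX; case: eqP => [<-|ne]; first by rewrite pihomog_dE // addnC.
rewrite mul0r; apply: pihomog_ne0 hX; rewrite addnC eqn_add2l; exact/eqP.
Qed.

Lemma pihomogMr_lt (R : comNzRingType) n d e (G F : {mpoly R[n]}) :
  F \is d.-homog -> (e < d)%N -> pihomog mdeg e (G * F) = 0.
Proof.
move=> hF ltd; rewrite [G]mpolyE mulr_suml raddf_sum big1 // => m _ /=.
have hX : 'X_[m] * F \is (mdeg m + d)%N.-homog by apply: dhomogM; rewrite ?dhomogX.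
rewrite -scalerAl linearZ /= (pihomog_ne0 _ hX) ?scaler0 //.
by rewrite gtn_eqF // (leq_trans ltd) // leq_addl.
Qed.

Lemma gen_idealE (C : fieldType) n r d (F : 'I_r -> dhomog n.+1 C d)
    (p : {mpoly C[n.+1]}) :
  gen_ideal (fun j => F j : {mpoly C[n.+1]}) p <->
  exists G : 'I_r -> {mpoly C[n.+1]}, p = \sum_j G j * F j.
Proof. by []. Qed.

(** The generators are homogeneous, so arbitrary coefficients may be replaced by their components of
    degree [t]. *)
Lemma gen_ideal_homog (C : fieldType) n r d t (F : 'I_r -> dhomog n.+1 C d)
    (p : dhomog n.+1 C (d + t)) :
  gen_ideal (fun j => F j : {mpoly C[n.+1]}) p <-> p \in ideal_part F t.
Proof.
rewrite mem_ideal_part gen_idealE; split=> [[G pG]|[G pG]];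
  last by exists (fun j => (G j : {mpoly C[n.+1]})).
exists (fun j => hproj t (G j)).
have <- : pihomog mdeg (d + t) p = p := pihomog_dE (dhomog_is_dhomog p).
rewrite pG raddf_sum.
by apply: eq_bigr => j _ /=; rewrite (pihomogMr _ _ (dhomog_is_dhomog (F j))).
Qed.

Lemma gen_ideal_lt (C : fieldType) n r d e (F : 'I_r -> dhomog n.+1 C d)
    (p : {mpoly C[n.+1]}) :
  p \is e.-homog -> (e < d)%N -> gen_ideal (fun j => F j : {mpoly C[n.+1]}) p -> p = 0.
Proof.
move=> hp ltd /gen_idealE[G pG]; rewrite -(pihomog_dE hp) pG raddf_sum big1 // => j _ /=.
exact: pihomogMr_lt (dhomog_is_dhomog (F j)) ltd.
Qed.

(** A power of ['X_ord0] lifts a syzygy of degree [t] to one of degree [i], and R is a domain. *)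
Lemma no_syzygy_le (C : fieldType) n r d i t (F : 'I_r -> dhomog n.+1 C d) :
  (t <= i)%N -> no_syzygy F i -> no_syzygy F t.
Proof.
move=> le nosyz G G0 j.
have hX : ('X_ord0 : {mpoly C[n.+1]}) ^+ (i - t) \is (i - t).-homog.
  by apply: dhomog1_exp; rewrite dhomogX /= mdeg1.
have hXG l : 'X_ord0 ^+ (i - t) * (G l : {mpoly C[n.+1]}) \is i.-homog.
  rewrite -[X in X.-homog](subnK le); apply: dhomogM (hX) _; exact: dhomog_is_dhomog.
have /nosyz /(_ j) /(congr1 val) /= /eqP :
    \sum_l (DHomog (hXG l) : {mpoly C[n.+1]}) * F l = 0.
  rewrite /= -[RHS](mulr0 ('X_ord0 ^+ (i - t))) -[in RHS]G0 mulr_sumr.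
  by apply: eq_bigr => l _; rewrite mulrA.
rewrite mulf_eq0 expf_eq0.
case/orP => [/andP[_ /eqP/(congr1 (mcoeff U_(ord0)))]|/eqP e]; last exact: val_inj.
by rewrite mcoeffX eqxx mcoeff0 => /eqP; rewrite oner_eq0.
Qed.

(** Provides I_m in the type of forms of degree [m], uniformly in the sign of [i - k]: it is
    [ideal_part F (i - k)] if [k <= i], and 0 otherwise because then [m < d]. Ideal membership
    serves the Lefschetz property, the explicit coefficients serve [independent_mod_power]. *)
Lemma exists_ideal_part (C : fieldType) n r d i k m (F : 'I_r -> dhomog n.+1 C d) :
  (d + i = m + k)%N -> no_syzygy F i ->
  exists J : {vspace dhomog n.+1 C m},
  [/\ \dim J = (r * rdim C n (i%:Z - k%:Z))%N,
      forall p, p \in J <-> gen_ideal (fun j => F j : {mpoly C[n.+1]}) p &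
      forall p, p \in J <-> exists Q : 'I_r -> {mpoly C[n.+1]},
        (forall j, is_form (i%:Z - k%:Z) (Q j)) /\ p = \sum_j Q j * F j :> {mpoly C[n.+1]}].
Proof.
move=> eD nosyz; have [le|lt] := leqP k i.
  have em : m = (d + (i - k))%N by rewrite addnBA // eD addnK.
  subst m; exists (ideal_part F (i - k)); rewrite subzn //; split.
  - exact/dim_ideal_part/no_syzygy_le/nosyz/leq_subr.
  - by move=> p; rewrite gen_ideal_homog.
  move=> p; rewrite mem_ideal_part; split=> [[G pG]|[Q [hQ pQ]]].
    by exists (fun j => (G j : {mpoly C[n.+1]})); split=> // j; apply: dhomog_is_dhomog.
  by exists (fun j => DHomog (hQ j : Q j \is (i - k).-homog)).
have ltm : (m < d)%N by rewrite -(ltn_add2r k) -eD ltn_add2l.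
have -> : i%:Z - k%:Z = Negz (k - i).-1.
  by rewrite NegzE prednK ?subn_gt0 // -subzn ?(ltnW lt) // opprB.
exists 0%VS; split; first by rewrite dimv0 muln0.
  move=> p; rewrite memv0; split=> [/eqP ->|I_p].
    by apply/gen_idealE; exists (fun=> 0); rewrite big1 // => j _; rewrite mul0r.
  by apply/eqP/val_inj/(gen_ideal_lt (dhomog_is_dhomog p) ltm I_p).
move=> p; rewrite memv0; split=> [/eqP ->|[Q [hQ pQ]]].
  by exists (fun=> 0); split=> [j|]; rewrite /= ?eqxx // big1 // => j _; rewrite mul0r.
apply/eqP/val_inj; rewrite /= pQ big1 // => j _.
by move: (hQ j) => /= /eqP ->; rewrite mul0r.
Qed.

(** * Multiplication by a power of a linear form *)

Section Multiplication.

Context (C : fieldType) (n r d i k m : nat) (F : 'I_r -> dhomog n.+1 C d).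
Context (eD : (d + i = m + k)%N) (nosyz : no_syzygy F i).
Context (J : {vspace dhomog n.+1 C m}).
Context (J_gen : forall p : dhomog n.+1 C m,
  p \in J <-> gen_ideal (fun j => F j : {mpoly C[n.+1]}) p).
Context (J_form : forall p : dhomog n.+1 C m,
  p \in J <-> exists Q : 'I_r -> {mpoly C[n.+1]},
    (forall j, is_form (i%:Z - k%:Z) (Q j)) /\ p = \sum_j Q j * F j :> {mpoly C[n.+1]}).

Implicit Types L : {mpoly C[n.+1]}.

Local Notation D := (d + i)%N.
Local Notation U := (ideal_part F i).
Local Notation I := (gen_ideal (fun j => F j : {mpoly C[n.+1]})).

Let mul L := linfun (@mul_power C n m D k L).

(* The rank of the multiplication by L^k from the degree-m part to the
   degree-D part of R/I. *)
Definition mult_rank L : nat :=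
  \dim (linear_projection U @: power_part m D k L).

(** It is taken in R_m; the kernel on the quotient (R/I)_m is obtained modulo [J]. *)
Definition mult_kernel L : {vspace dhomog n.+1 C m} := (mul L @^-1: U)%VS.

Lemma mulE L p : L \is 1.-homog -> mul L p = L ^+ k * p :> {mpoly C[n.+1]}.
Proof.
move=> hL; rewrite lfunE /= pihomog_dE // eD addnC; apply: dhomogM.
  exact: dhomog1_exp.
exact: dhomog_is_dhomog.
Qed.

(** Rank-nullity for the multiplication followed by the projection from [U]. *)
Lemma dim_mult_kernel L : (\dim (mult_kernel L) + mult_rank L = \dim {:dhomog n.+1 C m})%N.
Proof.
rewrite -(limg_ker_dim (linear_projection U \o mul L)%VF fullv) capfv limg_comp.
congr (\dim _ + _)%N; apply/vspaceP => p.
by rewrite memv_ker comp_lfunE -memv_ker lker_linear_projection memv_preim.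
Qed.

Lemma mult_rank_le L : (mult_rank L + \dim U <= \dim {:dhomog n.+1 C D})%N.
Proof. by rewrite dim_linear_projection dimvS ?subvf. Qed.

Lemma mem_mult_kernel L p : L \is 1.-homog -> p \in mult_kernel L <-> I (L ^+ k * p).
Proof. by move=> hL; rewrite -memv_preim -gen_ideal_homog mulE. Qed.

Lemma sub_mult_kernel L : L \is 1.-homog -> (J <= mult_kernel L)%VS.
Proof.
move=> hL; apply/subvP => p /J_gen/gen_idealE[G pG].
apply/(mem_mult_kernel _ hL)/gen_idealE; exists (fun j => L ^+ k * G j).
by rewrite pG mulr_sumr; apply: eq_bigr => j _; rewrite mulrA.
Qed.

Lemma mult_injE L : L \is 1.-homog ->
  mult_inj I (L ^+ k) m <-> (\dim (mult_kernel L) <= \dim J)%N.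
Proof.
move=> hL; split=> [inj|le p hp Ip].
  apply: dimvS; apply/subvP => p /(mem_mult_kernel _ hL) Ip; apply/J_gen.
  by apply: inj => //; apply: dhomog_is_dhomog.
have /eqP eJ : J == mult_kernel L by rewrite eqEdim sub_mult_kernel.
have : DHomog hp \in J by rewrite eJ; apply/(mem_mult_kernel _ hL).
by move/J_gen.
Qed.

Lemma mult_surjE L : L \is 1.-homog ->
  mult_surj I (L ^+ k) m (m%:Z + k%:Z) <->
  (\dim {:dhomog n.+1 C D} <= mult_rank L + \dim U)%N.
Proof.
move=> hL; rewrite dim_linear_projection -PoszD -eD; split=> [surj|le q hq].
  apply: dimvS; apply/subvP => q _.
  have [p hp /=] := surj q (dhomog_is_dhomog q).
  have -> : (q : {mpoly C[n.+1]}) - L ^+ k * p = (q - mul L (DHomog hp) : dhomog n.+1 C D).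
    by rewrite raddfB /= mulE.
  move/gen_ideal_homog => qU; rewrite -(subrK (mul L (DHomog hp)) q) addrC.
  by apply: memv_add => //; apply/memv_img/memvf.
have : DHomog (hq : q \is D.-homog) \in (power_part m D k L + U)%VS.
  suff -> : (power_part m D k L + U = fullv)%VS by rewrite memvf.
  by apply/eqP; rewrite eqEdim subvf.
case/memv_addP => _ /memv_imgP[p _ ->] [v vU qE].
exists p; first exact: dhomog_is_dhomog.
have -> : q - L ^+ k * p = v; last exact/gen_ideal_homog.
have {}qE : q = (mul L p + v : dhomog n.+1 C D) by exact: (congr1 val qE).
by rewrite qE raddfD /= mulE // addrC addKr.
Qed.

Lemma fails_SLPE :
  fails_SLP I k m <-> forall L, L \is 1.-homog ->
    (\dim J < \dim (mult_kernel L))%N /\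
    (mult_rank L + \dim U < \dim {:dhomog n.+1 C D})%N.
Proof.
split=> h L hL; have [a b] := h L hL.
  by rewrite !ltnNge; split; apply/negP => ?; [apply/a/mult_injE | apply/b/mult_surjE].
by split=> [/(mult_injE hL) | /(mult_surjE hL)]; rewrite leqNgt ?a ?b.
Qed.

(** A solution [G] determines [H] in the kernel, since R is a domain, and [H] determines [G], since
    there is no syzygy. The trivial solutions with entries in L^k R_(i-k) correspond to [H] in [J],
    so independence modulo the power is independence of the [H l] modulo [J]. *)
Lemma independent_solutionsE L q : L \is 1.-homog -> L != 0 ->
  (exists (G : 'I_q -> 'I_r -> dhomog n.+1 C i) (H : 'I_q -> {mpoly C[n.+1]}),
    [/\ independent_mod_power k L G, forall l, is_form m (H l) &
        forall l, \sum_(j < r) (G l j : {mpoly C[n.+1]}) * F j = L ^+ k * H l]) <->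
  (q + \dim J <= \dim (mult_kernel L))%N.
Proof.
move=> hL L0; split=> [[G [H [indep hH GH]]]|le].
  pose H' l : dhomog n.+1 C m := DHomog (hH l : H l \is m.-homog).
  apply: (@free_modulo_dim _ _ _ _ _ H'); first exact: sub_mult_kernel.
    move=> l; apply/(mem_mult_kernel _ hL)/gen_idealE.
    by exists (fun j => (G l j : {mpoly C[n.+1]})); rewrite GH.
  move=> c /J_form[Q [hQ eQ]]; apply: indep; exists Q => j; split=> //.
  (* For [i < k] the form [Q l] is 0, which is homogeneous of every degree. *)
  have hLQ l : L ^+ k * Q l \is i.-homog.
    move: (hQ l); have [le|lt] := leqP k i.
      rewrite subzn //= => hQl; rewrite -[X in X.-homog](subnKC le).
      by apply: dhomogM => //; apply: dhomog1_exp.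
    have -> : i%:Z - k%:Z = Negz (k - i).-1.
      by rewrite NegzE prednK ?subn_gt0 // -subzn ?(ltnW lt) // opprB.
    by move=> /= /eqP ->; rewrite mulr0 dhomog0.
  (* The combination of the [F l] with coefficients [S l] is [L ^+ k] times the difference of the
     two sides of [eQ], hence 0; so [S] is a syzygy of degree [i] and vanishes. *)
  pose S l : dhomog n.+1 C i := \sum_s c s *: G s l - DHomog (hLQ l).
  have SE l : S l = \sum_s c s *: (G s l : {mpoly C[n.+1]}) - L ^+ k * Q l :> {mpoly C[n.+1]}.
    rewrite raddfB raddf_sum; congr (_ - _); apply: eq_bigr => s _; exact: linearZ.
  suff /nosyz /(_ j) Sj : \sum_l (S l : {mpoly C[n.+1]}) * F l = 0.
    by apply/eqP; rewrite -subr_eq0 -SE Sj.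
  under eq_bigr => l _ do rewrite SE mulrBl mulr_suml.
  rewrite sumrB exchange_big /=.
  rewrite (eq_bigr (fun s => L ^+ k * (c s *: H s))) => [|s _]; last first.
    by rewrite -scalerAr -GH scaler_sumr; apply: eq_bigr => l _; rewrite scalerAl.
  rewrite -mulr_sumr (eq_bigr (fun l => L ^+ k * (Q l * F l))) => [|l _]; last by rewrite mulrA.
  rewrite -mulr_sumr -eQ raddf_sum /= -mulrBr.
  rewrite (eq_bigr (fun s => c s *: H s)) => [|s _]; last exact: linearZ.
  by rewrite subrr mulr0.
have [H HZ indep] := exists_free_modulo (sub_mult_kernel hL) le.
have /fin_all_exists[G GH] l : exists G : 'I_r -> dhomog n.+1 C i,
    \sum_j (G j : {mpoly C[n.+1]}) * F j = L ^+ k * H l.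
  by move: (HZ l); rewrite -memv_preim => /mem_ideal_part[G]; rewrite mulE // => e; exists G.
exists G, (fun l => H l : {mpoly C[n.+1]}); split=> // [c [Q hQ]|l];
  last exact: dhomog_is_dhomog.
apply: indep; apply/J_form; exists Q; split=> [j|]; first by case: (hQ j).
(* The identity is checked after multiplication by the nonzero power of [L]. *)
apply: (mulfI (expf_neq0 k L0)); rewrite raddf_sum !mulr_sumr.
transitivity (\sum_l c l *: \sum_j (G l j : {mpoly C[n.+1]}) * F j).
  by apply: eq_bigr => l _ /=; rewrite GH scalerAr.
under eq_bigr => l _ do rewrite scaler_sumr.
rewrite exchange_big /=; apply: eq_bigr => j _; rewrite mulrA -(hQ j).2 mulr_suml.
by apply: eq_bigr => l _; rewrite scalerAl.
Qed.

(** The coefficients of the linear form are polynomials in arbitrary parameters, which covers both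
    the space of all linear forms and the affine chart. *)
Lemma mult_rank_semicontinuous m' (c : 'I_n.+1 -> {mpoly C[m']}) (a0 : 'I_m' -> C) :
  exists2 q : {mpoly C[m']}, q.@[a0] != 0 & forall a, q.@[a] != 0 ->
    (mult_rank (\sum_j (c j).@[a0] *: 'X_j) <= mult_rank (\sum_j (c j).@[a] *: 'X_j))%N.
Proof.
pose b := vbasis {:dhomog n.+1 C m}; set N : nat := \dim {:dhomog n.+1 C m} in b.
(* The product of the universal power and the basis vector [l]. Its coefficients [Q l] are
   polynomial in the parameters, and the vectors [w l] do not depend on them. *)
pose G (l : 'I_N) : {mpoly {mpoly C[m']}[n.+1]} :=
  (\sum_j (c j)%:MP * 'X_j) ^+ k
    * map_mpoly (@mpolyC m' C) (tnth b l : {mpoly C[n.+1]}).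
pose K := (\max_l msize (G l))%N.
pose w (l : 'I_N) (be : 'X_{1..n.+1 < K}) := linear_projection U (hproj D 'X_[be]).
pose Q (l : 'I_N) (be : 'X_{1..n.+1 < K}) : {mpoly C[m']} := (G l)@_be.
have [q q0 hq] := dim_span_semicontinuous Q w a0.
suff rankE a : mult_rank (\sum_j (c j).@[a] *: 'X_j) =
    \dim <<[seq (\sum_(be : 'X_{1..n.+1 < K}) (Q l be).@[a] *: w l be)%R | l : 'I_N]>>.
  by exists q => // a qa; rewrite (rankE a0) (rankE a); apply: hq.
set L := (\sum_j _ *: _).
have evG l : map_mpoly (meval a) (G l) = L ^+ k * (tnth b l : {mpoly C[n.+1]}).
  rewrite rmorphM rmorphXn raddf_sum; congr (_ ^+ _ * _).
    by apply: eq_bigr => j _ /=; rewrite rmorphM /= map_mpolyC map_mpolyX mul_mpolyC.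
  by apply/mpolyP => be; rewrite !mcoeff_map_mpoly /= mevalC.
rewrite /mult_rank /power_part -limg_comp -(span_basis (vbasisP fullv)) limg_span.
rewrite -[X in map _ X](map_tnth_enum b) -map_comp; congr (\dim (span _)).
apply: eq_map => l /=; rewrite comp_lfunE lfunE /= /mul_power -evG.
rewrite (map_mpolyE _ (leq_bigmax l : (msize (G l) <= K)%N)) !raddf_sum.
by apply: eq_bigr => be _ /=; rewrite !linearZ.
Qed.

End Multiplication.

(** * Rescaling, general linear forms and the affine chart *)

Lemma power_part_scale (C : fieldType) n m D k (c : C) (L : {mpoly C[n.+1]}) :
  (power_part m D k (c *: L) <= power_part m D k L)%VS.
Proof.
apply: power_partP => al eal; rewrite exprZn -scalerAl linearZ memvZ //.
by apply: mem_power_part; rewrite dhomogX /= eal.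
Qed.

Lemma mult_rank_scale (C : fieldType) n r d i k m (F : 'I_r -> dhomog n.+1 C d)
    (c : C) (L : {mpoly C[n.+1]}) :
  (mult_rank i k m F (c *: L) <= mult_rank i k m F L)%N.
Proof. exact/dimvS/limgS/power_part_scale. Qed.

Definition linear_form (C : fieldType) n (a : 'I_n.+1 -> C) : {mpoly C[n.+1]} :=
  \sum_j a j *: 'X_j.

Lemma linear_form_homog (C : fieldType) n (a : 'I_n.+1 -> C) : linear_form a \is 1.-homog.
Proof. by apply: rpred_sum => j _; apply: rpredZ; rewrite dhomogX /= mdeg1. Qed.

Lemma linear_formK (C : fieldType) n (a : 'I_n.+1 -> C) : dual_point (linear_form a) =1 a.
Proof.
move=> j; rewrite /dual_point /linear_form raddf_sum (bigD1 j) //= big1 => [|l lj].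
  by rewrite mcoeffZ mcoeffX eqxx mulr1 addr0.
by rewrite mcoeffZ mcoeffX eq_mnm1 (negPf lj) mulr0.
Qed.

Lemma dual_pointK (C : fieldType) n (L : {mpoly C[n.+1]}) :
  L \is 1.-homog -> linear_form (dual_point L) = L.
Proof. by move=> hL; rewrite [RHS]dhomog1_sum. Qed.

Lemma linear_form_chart (C : fieldType) n (a : 'I_n.+1 -> C) : a ord0 != 0 ->
  chart (fun j => (a ord0)^-1 * a (lift ord0 j)) = (a ord0)^-1 *: linear_form a.
Proof.
move=> a0; rewrite /linear_form big_ord_recl scalerDr scalerA mulVf // scale1r.
by congr (_ + _); rewrite scaler_sumr; apply: eq_bigr => j _; rewrite scalerA.
Qed.

Lemma mult_rank_generic (C : fieldType) n r d i k m (F : 'I_r -> dhomog n.+1 C d)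
    (L : {mpoly C[n.+1]}) : L \is 1.-homog ->
  exists2 q : {mpoly C[n.+1]}, q != 0 & forall a, q.@[a] != 0 ->
    (mult_rank i k m F L <= mult_rank i k m F (linear_form a))%N.
Proof.
move=> hL.
have [q q0 hq] := mult_rank_semicontinuous i k m F (fun j => 'X_j) (dual_point L).
exists q => [|a /hq]; first by apply: contraNneq q0 => ->; rewrite meval0.
have XE a' : \sum_j ('X_j).@[a'] *: 'X_j = linear_form a'.
  by apply: eq_bigr => j _; rewrite mevalXU.
by rewrite !XE dual_pointK.
Qed.

Lemma mult_rank_chart_generic (C : fieldType) n r d i k m
    (F : 'I_r -> dhomog n.+1 C d) (t0 : 'I_n -> C) :
  exists2 q : {mpoly C[n]}, q != 0 & forall t, q.@[t] != 0 ->
    (mult_rank i k m F (chart t0) <= mult_rank i k m F (chart t))%N.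
Proof.
(* The coefficients of [chart t] as polynomials in [t], with 1 at ['X_ord0]. *)
pose c j : {mpoly C[n]} := if unlift ord0 j is Some j' then 'X_j' else 1.
have [q q0 hq] := mult_rank_semicontinuous i k m F c t0.
exists q => [|t /hq]; first by apply: contraNneq q0 => ->; rewrite meval0.
have cE t' : \sum_j (c j).@[t'] *: 'X_j = chart t'.
  rewrite big_ord_recl /c unlift_none meval1 scale1r; congr (_ + _).
  by apply: eq_bigr => j _; rewrite liftK mevalXU.
by rewrite !cE.
Qed.

Lemma exists_max_value (T : Type) (f : T -> nat) b (t0 : T) :
  (forall t, f t <= b)%N -> exists t, forall t', (f t' <= f t)%N.
Proof.
move=> fb; have [s] := ubnP (b - f t0); elim: s t0 => // s IH t0 lt.
have [[t' ltt]|nmax] := boolp.EM (exists t', f t0 < f t')%N.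
  by apply: (IH t'); have := fb t'; lia.
by exists t0 => t'; rewrite leqNgt; apply/negP => ?; apply: nmax; exists t'.
Qed.

(** * Apolar forms with a point of high multiplicity *)

(** On forms of equal degree the action is constant, so its constant coefficient is a bilinear form
    that detects its vanishing. Each of the two conditions is orthogonality to one summand. *)
Lemma apolar_multiplicityE (C : numFieldType) n m k D (U : {vspace dhomog n.+1 C D})
    (L : {mpoly C[n.+1]}) (f : dhomog n.+1 C D) :
  D = (m + k)%N -> (0 < k)%N -> L \is 1.-homog ->
  apolar U f /\ multiplicity_ge (m%:Z + 1) (dual_point L) f <->
  forall g, g \in (power_part m D k L + U)%VS -> (diff_action f g)@_0%MM = 0.
Proof.
move=> eD k0 hL.
have constE (g : dhomog n.+1 C D) : (diff_action f g)@_0%MM = 0 <-> diff_action f g = 0.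
  split=> [|->]; last by rewrite mcoeff0.
  rewrite (diff_action_dhomog (dhomog_is_dhomog f) (dhomog_is_dhomog g)) mcoeffC eqxx mulr1.
  by move=> ->; rewrite mpolyC0.
have hf : (f : {mpoly C[n.+1]}) \is (m + k).-homog by rewrite -eD; apply: dhomog_is_dhomog.
have hLp p : p \is m.-homog -> L ^+ k * p \is D.-homog.
  by move=> hp; rewrite eD addnC; apply: dhomogM => //; apply: dhomog1_exp.
rewrite (multiplicity_geP hL hf k0); split=> [[apU orth] g|orth].
  case/memv_addP => _ /memv_imgP[p _ ->] [v vU ->]; apply/constE.
  rewrite raddfD /= (apU _ vU) addr0 lfunE /= pihomog_dE; last exact/hLp/dhomog_is_dhomog.
  exact/orth/dhomog_is_dhomog.
split=> [g gU|p hp]; first by apply/constE/orth/(subvP (addvSr _ _)).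
rewrite -(hprojK (hLp p hp)); apply/constE/orth/(subvP (addvSl _ _)).
exact: mem_power_part.
Qed.

Lemma dim_ge_diff_action (C : numFieldType) n D (S : {vspace dhomog n.+1 C D}) q :
  dim_ge (fun f : dhomog n.+1 C D =>
    forall g, g \in S -> (diff_action f g)@_0%MM = 0) q <->
  (q + \dim S <= \dim {:dhomog n.+1 C D})%N.
Proof.
apply: (@dim_ge_orthogonal _ _ (fun f g : dhomog n.+1 C D => (diff_action f g)@_0%MM)).
- by move=> g c f f'; rewrite /= diff_action_linearl mcoeffD mcoeffZ.
- by move=> f c g g'; rewrite /= diff_action_linearr mcoeffD mcoeffZ.
move=> g orth; apply/val_inj/(diff_action_nondegenerate (dhomog_is_dhomog g)) => f hf.
have := orth (DHomog hf); rewrite /= (diff_action_dhomog hf (dhomog_is_dhomog g)).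
by rewrite mcoeffC eqxx mulr1 => ->; rewrite mpolyC0.
Qed.

Lemma dim_ge_apolar (C : numFieldType) n m k D (U : {vspace dhomog n.+1 C D})
    (L : {mpoly C[n.+1]}) q :
  D = (m + k)%N -> (0 < k)%N -> L \is 1.-homog ->
  dim_ge (fun f : dhomog n.+1 C D =>
    apolar U f /\ multiplicity_ge (m%:Z + 1) (dual_point L) f) q <->
  (q + \dim (power_part m D k L + U) <= \dim {:dhomog n.+1 C D})%N.
Proof.
move=> eD k0 hL; rewrite (eq_dim_ge _ (fun f => apolar_multiplicityE U f eD k0 hL)).
exact: dim_ge_diff_action.
Qed.

(** * Arithmetic of the dimension counts *)

(** Here and below [a], [e], [R], [u] stand for the dimensions of R_m, I_m, R_D, I_D with D = d + i.
    The first [minn] on the right is the number of trivial Laplace equations, by which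
    [minn a (R - u)] exceeds the maximal possible rank [minn (a - e) (R - u)]. *)
Lemma laplace_countE (rk a e R u dl : nat) : (e + rk <= a)%N -> (rk + u <= R)%N ->
  (rk%:Z - 1 = Num.min (a%:Z - 1) ((R - u)%:Z - 1)
               - (minn (R + e - (u + a)) e + dl)%:Z) <->
  (rk + dl = minn (a - e) (R - u))%N.
Proof.
move=> le1 le2.
have minE : Num.min (a%:Z - 1) ((R - u)%:Z - 1) = (minn a (R - u))%:Z - 1 by lia.
have split : (minn a (R - u) = minn (R + e - (u + a)) e + minn (a - e) (R - u))%N by lia.
rewrite minE split PoszD; split; lia.
Qed.

(** The truncated difference is N^+, which is [a - e] minus the maximal possible rank. *)
Lemma kernel_countE (ker rk a e R u dl : nat) :
  (ker + rk = a)%N -> (e <= ker)%N -> (rk + u <= R)%N ->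
  (u + a - (R + e) + dl + e <= ker)%N = (rk + dl <= minn (a - e) (R - u))%N.
Proof. lia. Qed.

(** The truncated difference is N^-, which is [R - u] minus the maximal possible rank. *)
Lemma cokernel_countE (rk a e R u dl : nat) : (e + rk <= a)%N -> (rk + u <= R)%N ->
  (R + e - (u + a) + dl + (rk + u) <= R)%N = (rk + dl <= minn (a - e) (R - u))%N.
Proof. lia. Qed.

Lemma fails_countE (ker rk a e R u : nat) : (ker + rk = a)%N ->
  (e < ker)%N && (rk + u < R)%N = (rk < minn (a - e) (R - u))%N.
Proof. lia. Qed.

(** * The equivalence *)

Lemma lefschetz_equivalence (C : numFieldType) (n r d i k m : nat)
    (F : 'I_r -> dhomog n.+1 C d) :
  (d + i = m + k)%N -> (0 < k)%N -> no_syzygy F i ->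
  [<->
    fails_SLP (gen_ideal (fun j => F j : {mpoly C[n.+1]})) k m;
    exists2 delta : nat, (1 <= delta)%N &
      general_linear_form (fun L : {mpoly C[n.+1]} =>
        exists (G : 'I_(Nplus C n r i k d + delta) -> 'I_r -> dhomog n.+1 C i)
               (H : 'I_(Nplus C n r i k d + delta) -> {mpoly C[n.+1]}),
          [/\ independent_mod_power k L G,
              forall l, is_form m (H l)
            & forall l, \sum_(j < r) (G l j : {mpoly C[n.+1]}) * F j
                        = L ^+ k * H l]);
    exists2 delta : nat, (1 <= delta)%N &
      satisfies_laplace ((ideal_part F i)^C)%VS
        (projected_veronese (ideal_part F i)) m
        (trivial_laplace C n r i k d + delta);
    exists2 delta : nat, (1 <= delta)%N &
      forall L : {mpoly C[n.+1]}, L \is 1.-homog -> L != 0 ->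
        dim_ge (fun f : dhomog n.+1 C (d + i) =>
                  apolar (ideal_part F i) f /\
                  multiplicity_ge (m%:Z + 1) (dual_point L) f)
               (Nminus C n r i k d + delta)].
Proof.
move=> eD k0 nosyz.
have [J [dimJ J_gen J_form]] := exists_ideal_part eD nosyz.
have dimU := dim_ideal_part nosyz.
pose a := \dim {:dhomog n.+1 C m}; pose R := \dim {:dhomog n.+1 C (d + i)}.
pose u := \dim (ideal_part F i); pose e := \dim J.
pose rk := mult_rank i k m F.
have NE : Nnum C n r i k d = u%:Z + a%:Z - (R%:Z + e%:Z).
  have em : (d + i)%:Z - k%:Z = m%:Z by rewrite eD PoszD addrK.
  rewrite /Nnum em /u dimU /e dimJ !PoszM [rdim C n m]/= -/a [rdim C n (d + i)]/= -/R.
  rewrite [rdim C n i]/=; ring.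
have NpE : Nplus C n r i k d = (u + a - (R + e))%N by rewrite /Nplus NE; lia.
have NmE : Nminus C n r i k d = (R + e - (u + a))%N by rewrite /Nminus NE; lia.
have trivE : trivial_laplace C n r i k d = minn (R + e - (u + a)) e.
  by rewrite /trivial_laplace NmE -dimJ.
have oscE : osc_binomial n m = a.
  rewrite /a dimvf; have -> : dim (dhomog n.+1 C m) = 'C(m + n, m) by [].
  by rewrite /osc_binomial -[RHS]bin_sub ?leq_addr // addKn addnC.
have kerE L : (\dim (mult_kernel i k m F L) + rk L = a)%N := dim_mult_kernel i k m F L.
have rkU L : (rk L + u <= R)%N := mult_rank_le i k m F L.
have leJ L : L \is 1.-homog -> (e <= \dim (mult_kernel i k m F L))%N.
  by move=> hL; apply/dimvS/(sub_mult_kernel eD J_gen hL).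
have eRK L : L \is 1.-homog -> (e + rk L <= a)%N.
  by move=> hL; rewrite -(kerE L) leq_add2r leJ.
pose M := minn (a - e) (R - u).
have failE : fails_SLP (gen_ideal (fun j => F j : {mpoly C[n.+1]})) k m <->
    forall L, L \is 1.-homog -> (rk L < M)%N.
  rewrite (fails_SLPE eD J_gen); split=> h L hL; move: (h L hL);
    rewrite -(fails_countE e R u (kerE L)); first by case=> lt1 lt2; apply/andP.
  by move/andP.
have solE dl L (hL : L \is 1.-homog) (L0 : L != 0) := @independent_solutionsE
  C n r d i k m F eD nosyz J J_gen J_form L (Nplus C n r i k d + dl) hL L0.
have kerM dl L : L \is 1.-homog ->
    (Nplus C n r i k d + dl + \dim J <= \dim (mult_kernel i k m F L))%N = (rk L + dl <= M)%N.
  by move=> hL; rewrite NpE (kernel_countE dl (kerE L) (leJ L hL) (rkU L)).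
have lapE dl t : _ <-> (rk (chart t) + dl = M)%N :=
  laplace_countE dl (eRK _ (chart_homog t)) (rkU (chart t)).
have osE t : \dim (osculating (projected_veronese (ideal_part F i)) m t) = rk (chart t).
  by rewrite (osculating_projected_veronese _ _ eD).
have dimUc : \dim (ideal_part F i)^C = (R - u)%N by rewrite dimv_compl.
have apE dl L (hL : L \is 1.-homog) := @dim_ge_apolar
  C n m k _ (ideal_part F i) L (Nminus C n r i k d + dl) eD k0 hL.
have cokerM dl L : L \is 1.-homog ->
    (Nminus C n r i k d + dl + \dim (power_part m (d + i) k L + ideal_part F i)
       <= \dim {:dhomog n.+1 C (d + i)})%N = (rk L + dl <= M)%N.
  by move=> hL; rewrite NmE -dim_linear_projection (cokernel_countE dl (eRK L hL) (rkU L)).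
have generic L : L \is 1.-homog -> exists2 q : {mpoly C[n.+1]}, q != 0 &
    forall b, q.@[b] != 0 -> (rk L <= rk (linear_form b))%N :=
  @mult_rank_generic C n r d i k m F L.
have generic_chart (t0 : 'I_n -> C) : exists2 q : {mpoly C[n]}, q != 0 &
    forall t, q.@[t] != 0 -> (rk (chart t0) <= rk (chart t))%N :=
  mult_rank_chart_generic i k m F t0.
have scale c L : (rk (c *: L) <= rk L)%N := mult_rank_scale i k m F c L.
have X0 : ('X_ord0 : {mpoly C[n.+1]}) != 0.
  by apply/eqP => /(congr1 (mcoeff U_(ord0))) /eqP; rewrite mcoeffX eqxx mcoeff0 oner_eq0.
have nz (L : {mpoly C[n.+1]}) : dual_point L ord0 != 0 -> L != 0.
  by apply: contraNneq => ->; rewrite /dual_point mcoeff0.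
(* Two nonempty open sets share a point, which moreover can be rescaled into the chart. *)
have common (q1 q2 : {mpoly C[n.+1]}) : q1 != 0 -> q2 != 0 ->
    exists a, [/\ q1.@[a] != 0, q2.@[a] != 0 & a ord0 != 0].
  move=> n1 n2; have [b] := mpoly_exists_nonzero (mulf_neq0 (mulf_neq0 n1 n2) X0).
  rewrite !mevalM mevalXU !mulf_eq0 !negb_or => /andP[/andP[? ?] ?].
  by exists b.
clearbody rk M.
tfae.
(* The open set where the coefficient of ['X_ord0] is nonzero serves only to exclude [L = 0]. *)
- move/failE => h; exists 1%N => //; exists 'X_ord0 => // L hL; rewrite mevalXU => L0.
  by apply/(solE _ _ hL (nz _ L0)); rewrite kerM // addn1 h.
- case=> dl dl0 [q q0 hq].
  (* The rank of any [L] is at most that of a general linear form, to which the hypothesis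
     applies. *)
  have h L : L \is 1.-homog -> (rk L < M)%N.
    move=> hL; have [q1 q1n hq1] := generic _ hL.
    have [b [qb q1b b0]] := common _ _ q0 q1n.
    have hb := linear_form_homog b.
    have Lb0 : linear_form b != 0 by apply: nz; rewrite linear_formK.
    have qb' : q.@[dual_point (linear_form b)] != 0 by rewrite (meval_eq _ (linear_formK b)).
    have /(solE _ _ hb Lb0) := hq _ hb qb'.
    by rewrite kerM //; apply: leq_trans; rewrite -addn1 leq_add ?hq1.
  (* [satisfies_laplace] is an equality, so delta has to be the exact deficit of the largest rank on
     the chart, which is attained at a general point. *)
  have [t0 maxt] := @exists_max_value _ (fun t : 'I_n -> C => rk (chart t)) M (fun=> 0)
    (fun t => ltnW (h _ (chart_homog t))).
  have ht0 := h _ (chart_homog t0).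
  exists (M - rk (chart t0))%N; first by rewrite subn_gt0.
  have [q1 q1n hq1] := generic_chart t0.
  exists q1 => // t /hq1 ge; rewrite osE oscE dimUc trivE; apply/lapE.
  have -> : rk (chart t) = rk (chart t0) by apply/eqP; rewrite eqn_leq ge maxt.
  by rewrite subnKC // ltnW.
(* The rank increases weakly from [L] to a general linear form, is not lowered by rescaling into the
   chart at [t0], and increases weakly again to a general [t], where it is [M - dl]. *)
- case=> dl dl0 [q q0 hq]; exists 1%N => // L hL _; apply/(apE _ _ hL); rewrite cokerM //.
  have [q1 q1n hq1] := generic _ hL.
  have [b [q1b _ b0]] := common _ _ q1n q1n.
  pose t0 j := (b ord0)^-1 * b (lift ord0 j).
  have get0 : (rk L <= rk (chart t0))%N.
    apply: leq_trans (hq1 _ q1b) _.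
    have -> : linear_form b = b ord0 *: chart t0.
      by rewrite linear_form_chart // scalerA mulfV // scale1r.
    exact: scale.
  have [q2 q2n hq2] := generic_chart t0.
  have [t] := mpoly_exists_nonzero (mulf_neq0 q0 q2n).
  rewrite mevalM mulf_eq0 negb_or => /andP[/hq + /hq2 get].
  rewrite osE oscE dimUc trivE => /lapE <-.
  by rewrite leq_add // (leq_trans get0).
case=> dl dl0 h; apply/failE.
have lt L : L \is 1.-homog -> L != 0 -> (rk L < M)%N.
  move=> hL L0; have /(apE _ _ hL) := h L hL L0.
  by rewrite cokerM //; apply: leq_trans; rewrite -addn1 leq_add.
move=> L hL; have [->|] := eqVneq L 0; last exact: lt.
(* The fourth condition leaves out [L = 0]; as a multiple of ['X_ord0] it has no larger rank. *)
rewrite -(scale0r ('X_ord0 : {mpoly C[n.+1]})).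
by apply: leq_ltn_trans (scale _ _) (lt _ _ X0); rewrite dhomogX /= mdeg1.
Qed.

(** In negative degree each of the four conditions is contradictory, which is what each implication
    proves. *)
Lemma lefschetz_equivalence_small (C : numFieldType) (n r d i k s : nat)
    (F : 'I_r -> dhomog n.+1 C d) :
  (d + i < k)%N -> no_syzygy F i ->
  [<->
    fails_SLP (gen_ideal (fun j => F j : {mpoly C[n.+1]})) k (Negz s);
    exists2 delta : nat, (1 <= delta)%N &
      general_linear_form (fun L : {mpoly C[n.+1]} =>
        exists (G : 'I_(Nplus C n r i k d + delta) -> 'I_r -> dhomog n.+1 C i)
               (H : 'I_(Nplus C n r i k d + delta) -> {mpoly C[n.+1]}),
          [/\ independent_mod_power k L G,
              forall l, is_form (Negz s) (H l)
            & forall l, \sum_(j < r) (G l j : {mpoly C[n.+1]}) * F j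
                        = L ^+ k * H l]);
    exists2 delta : nat, (1 <= delta)%N &
      satisfies_laplace ((ideal_part F i)^C)%VS
        (projected_veronese (ideal_part F i)) (Negz s)
        (trivial_laplace C n r i k d + delta);
    exists2 delta : nat, (1 <= delta)%N &
      forall L : {mpoly C[n.+1]}, L \is 1.-homog -> L != 0 ->
        dim_ge (fun f : dhomog n.+1 C (d + i) =>
                  apolar (ideal_part F i) f /\
                  multiplicity_ge (Negz s + 1) (dual_point L) f)
               (Nminus C n r i k d + delta)].
Proof.
move=> lt nosyz; have negE t : (t < k)%N -> t%:Z - k%:Z = Negz (k - t).-1 by lia.
tfae.
(* A map from the zero space is injective. *)
- move=> h; have [ninj _] := h 0 (dhomog0 _ _ _); case: ninj => p /eqP -> _; apply/gen_idealE.
  by exists (fun=> 0); rewrite big1 // => j _; rewrite mul0r.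
- case=> dl dl0 [q /mpoly_exists_nonzero[a qa] hq].
  have [|G [H [indep hH GH]]] := hq _ (linear_form_homog a).
    by rewrite (meval_eq _ (linear_formK a)).
  (* All [H l] are 0, so the [G l] are syzygies; but at least one of the vectors should be
     independent. *)
  have G0 l j : G l j = 0.
    by apply: nosyz; rewrite GH (eqP (hH l)) mulr0.
  have lt0 : (0 < Nplus C n r i k d + dl)%N by rewrite addn_gt0 dl0 orbT.
  have /(_ _ (Ordinal lt0)) /eqP := indep (fun=> 1); rewrite oner_eq0 => /(_ _) F0.
  suff : false by []. apply: F0; exists (fun=> 0) => j; split.
    by case: (i%:Z - k%:Z) => t /=; rewrite ?dhomog0.
  by rewrite mulr0 big1 // => l _; rewrite G0 scaler0.
(* The osculating space is empty, of dimension -1, which is also the expected dimension; this leaves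
   no room for a positive delta. *)
- case=> dl dl0 [q /mpoly_exists_nonzero[t /[swap] /[apply]]].
  rewrite /osculating /osc_binomial dimv0; lia.
case=> dl dl0 /(_ 'X_ord0); case; first by rewrite dhomogX /= mdeg1.
  by apply/eqP => /(congr1 (mcoeff U_(ord0))) /eqP; rewrite mcoeffX eqxx mcoeff0 oner_eq0.
(* Apolarity alone bounds the dimension by that of (R/I)_(d+i), which is here N^-. *)
move=> X fX XP; have : dim_ge (fun f : dhomog n.+1 C (d + i) =>
    forall g, g \in ideal_part F i -> (diff_action f g)@_0%MM = 0) (Nminus C n r i k d + dl).
  by exists X => // f /XP[apf _] g gU; rewrite apf // mcoeff0.
pose u := (r * \dim {:dhomog n.+1 C i})%N; pose R := \dim {:dhomog n.+1 C (d + i)}.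
have NE : Nnum C n r i k d = u%:Z - R%:Z.
  rewrite /Nnum (negE _ lt) (negE _ (leq_ltn_trans (leq_addl d i) lt)).
  by rewrite /rdim -/R !subr0 -PoszM.
move/dim_ge_diff_action; rewrite dim_ideal_part // /Nminus NE -/u -/R => le.
by exfalso; clearbody u R; lia.
Qed.

Theorem theorem5p1 (K : realType) (n r d i k : nat)
    (F : 'I_r -> dhomog n.+1 K[i] d)
    (hk : (1 <= k)%N)
    (hart : artinian_ideal (gen_ideal (fun j => F j : {mpoly K[i][n.+1]})))
    (hsyz : no_syzygy F i) :
  [<->
    fails_SLP (gen_ideal (fun j => F j : {mpoly K[i][n.+1]})) k
      ((d + i)%:Z - k%:Z);
    exists2 delta : nat, (1 <= delta)%N &
      general_linear_form (fun L : {mpoly K[i][n.+1]} =>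
        exists (G : 'I_(Nplus K[i] n r i k d + delta) -> 'I_r -> dhomog n.+1 K[i] i)
               (H : 'I_(Nplus K[i] n r i k d + delta) -> {mpoly K[i][n.+1]}),
          [/\ independent_mod_power k L G,
              forall l, is_form ((d + i)%:Z - k%:Z) (H l)
            & forall l, \sum_(j < r) (G l j : {mpoly K[i][n.+1]}) * F j
                        = L ^+ k * H l]);
    exists2 delta : nat, (1 <= delta)%N &
      satisfies_laplace ((ideal_part F i)^C)%VS
        (projected_veronese (ideal_part F i)) ((d + i)%:Z - k%:Z)
        (trivial_laplace K[i] n r i k d + delta);
    exists2 delta : nat, (1 <= delta)%N &
      forall L : {mpoly K[i][n.+1]}, L \is 1.-homog -> L != 0 ->
        dim_ge (fun f : dhomog n.+1 K[i] (d + i) =>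
                  apolar (ideal_part F i) f /\
                  multiplicity_ge ((d + i)%:Z - k%:Z + 1) (dual_point L) f)
               (Nminus K[i] n r i k d + delta)].
Proof.
have [le|lt] := leqP k (d + i).
  have -> : (d + i)%:Z - k%:Z = (d + i - k)%N%:Z by rewrite subzn.
  by apply: lefschetz_equivalence => //; rewrite subnK.
have -> : (d + i)%:Z - k%:Z = Negz (k - (d + i)).-1 by lia.
exact: lefschetz_equivalence_small.
Qed.
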